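(* Let $\tau>0$, $\xi\in\mathbb{R}$, and let $N\colon[0,\tau]\to\mathbb{R}$ be an integrable function. Let $\Delta\colon\mathbb{C}\to\mathbb{C}$ be defined by $$\Delta(s)=1-\xi e^{-s\tau}-\int_0^\tau N(\nu)e^{-s\nu}\,d\nu .$$ Assume that $|\xi|<1$, that $\Delta$ has no roots on the imaginary axis, and that $$\int_0^\tau N(\nu)\,d\nu<1-\xi .$$ Let $M(\omega)=\operatorname{Re}(\Delta(i\omega))$ and $S(\omega)=\operatorname{Im}(\Delta(i\omega))$ for $\omega\in\mathbb{R}$, and let $\rho_1,\dots,\rho_m$ be the positive zeros of $M$, repeated according to their multiplicities and ordered so that $0<\rho_m\le\cdots\le\rho_1$. Then the number of roots of $\Delta$ lying in $\{s\in\mathbb{C}\mid \operatorname{Re}(s)>0\}$, counted by multiplicity, is equal to $$\Gamma:=\sum_{j=1}^m(-1)^{j-1}\operatorname{sgn}\bigl(S(\rho_j)\bigr).$$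
   Context: $\operatorname{sgn}$ denotes the sign function. If $M$ has no positive zeros, then $m=0$ and $\Gamma=0$ (empty sum). Under the assumption $|\xi|<1$, the function $M$ has only finitely many positive zeros, so $m$ is a finite number. *)

(* Defs.v *)
From HB Require Import structures.
From mathcomp Require Import all_boot all_order all_algebra.
From mathcomp Require Import all_classical all_reals all_analysis.
From mathcomp.real_closed Require Import complex.

Set Implicit Arguments.
Unset Strict Implicit.
Unset Printing Implicit Defensive.
Import Order.TTheory GRing.Theory Num.Theory.
Import numFieldNormedType.Exports.

Local Open Scope classical_set_scope.
Local Open Scope ring_scope.
Local Open Scope complex_scope.

(** [z] is a zero of [f] of multiplicity exactly [k]; [k = 0] means that [f]
    does not vanish at [z].  For [K] real (resp. complex) the derivatives are the
    real (resp. complex) ones.  They are total, hence meaningful here only for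
    infinitely differentiable [f], such as the functions below. *)
Definition zero_mult (K : numFieldType) (f : K -> K) (z : K) (k : nat) : Prop :=
  (forall j, (j < k)%N -> (f^`(j))%classic z = 0) /\ (f^`(k))%classic z != 0.

(** [s] lists the zeros of [f] in [A], each one as often as its multiplicity. *)
Definition lists_zeros (K : numFieldType) (f : K -> K) (A : set K) (s : seq K)
    : Prop :=
  (forall z, z \in s -> A z) /\
  (forall z, A z -> zero_mult f z (count_mem z s)).

Section delta.
Variable R : realType.
Local Notation mu := (@lebesgue_measure R).

Definition cexp (z : R[i]) : R[i] :=
  (expR (complex.Re z))%:C *
  (cos (complex.Im z) +i* sin (complex.Im z)).

Definition cintegral (D : set R) (f : R -> R[i]) : R[i] :=
  Rintegral mu D (fun x => complex.Re (f x)) +i*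
  Rintegral mu D (fun x => complex.Im (f x)).

Variables (tau xi : R) (N : R -> R).

Definition Delta (s : R[i]) : R[i] :=
  1 - xi%:C * cexp (- (s * tau%:C))
    - cintegral `[0, tau] (fun nu => (N nu)%:C * cexp (- (s * nu%:C))).

Definition Mfun (omega : R) : R := complex.Re (Delta (0 +i* omega)).

Definition Sfun (omega : R) : R := complex.Im (Delta (0 +i* omega)).

(** The list [rho] is indexed from 0, so the [j]-th term below is the
    [(j+1)]-st one of the usual 1-based sum. *)
Definition Gamma (rho : seq R) : R :=
  \sum_(j < size rho) (-1) ^+ j * Num.sg (Sfun rho`_j).

End delta.

(* Main.v *)
(* Let z_1, ..., z_n be the zeros of Delta in the right half-plane.  They are finitely many,
   because Re Delta > 0 far away there, by Riemann-Lebesgue and |xi| < 1.  The quotient of Delta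
   by the product of the s - z_j extends to a continuous function without zeros, which has a
   continuous argument on a large half-disc.  Comparing it with the principal argument of Delta
   on the arc, where Re Delta > 0, shows that the argument of Delta decreases by n pi, up to
   less than pi/2, as s goes from 0 to i W.  On the other hand this decrease can be read off
   from the zeros of M on ]0, W[: when M has a zero of odd multiplicity, the multiple of pi
   nearest to the argument jumps by +1 or -1, according to the sign of S there and the sign of
   M just above it. *)

Require Import Defs.
From HB Require Import structures.
From mathcomp Require Import all_boot all_order all_algebra.
From mathcomp Require Import all_classical all_reals all_analysis.
From mathcomp.real_closed Require Import complex.
From mathcomp Require Import ring lra.
Import Order.TTheory GRing.Theory Num.Theory.
Import numFieldNormedType.Exports.
Local Open Scope classical_set_scope.
Local Open Scope ring_scope.
Local Open Scope complex_scope.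
Set Implicit Arguments.
Unset Strict Implicit.
Unset Printing Implicit Defensive.
Local Notation Re := complex.Re.
Local Notation Im := complex.Im.
Import ComplexField.Normc.

(** * Real and imaginary parts, arguments of complex numbers *)

(** No contour integral and no theory of holomorphic functions is used. Apart from Riemann-Lebesgue,
    the analytic input is one family of estimates: the [n]-th derivative of Delta is bounded by a
    constant times [tau^n e^(tau |z|)], so Delta is everywhere the limit of its Taylor polynomials
    at any point. As [M(0) = 1 - xi - int N] is positive, this yields finite multiplicities and
    isolated zeros; the same expansions make the quotient continuous. Winding is expressed by real
    arguments that are continuous along curves: two of them for the same curve differ by a constant,
    since their difference only takes values in the multiples of 2 pi. Enclosing [n] zeros gives a
    variation of 2 n pi on the segment from -iW to iW, up to the contribution of the arc; the
    symmetry of Delta under conjugation halves it. No limit in [W] is needed: Delta(0) is real, so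
    the argument at 0 is exactly some [k0 pi], and the error at [iW] is a principal argument, so the
    multiple of pi nearest to the argument at [iW] has index exactly [k0 - n]. What remains is an
    equality of integers. *)

Section complex_arguments.
Variable R : realType.
Implicit Types (z w : R[i]) (a b t x y : R).

Lemma complex_eq z w : Re z = Re w -> Im z = Im w -> z = w.
Proof. by case: z w => [a b] [c d] /= -> ->. Qed.

Lemma Re_add z w : Re (z + w) = Re z + Re w. Proof. by case: z w => [a b] [c d]. Qed.
Lemma Im_add z w : Im (z + w) = Im z + Im w. Proof. by case: z w => [a b] [c d]. Qed.
Lemma Re_opp z : Re (- z) = - Re z. Proof. by case: z. Qed.
Lemma Im_opp z : Im (- z) = - Im z. Proof. by case: z. Qed.
Lemma Re_mul z w : Re (z * w) = Re z * Re w - Im z * Im w.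
Proof. by case: z w => [a b] [c d]. Qed.
Lemma Im_mul z w : Im (z * w) = Re z * Im w + Im z * Re w.
Proof. by case: z w => [a b] [c d]. Qed.
Lemma Re_inv z : Re z^-1 = Re z / (Re z ^+ 2 + Im z ^+ 2).
Proof. by case: z. Qed.
Lemma Im_inv z : Im z^-1 = - (Im z / (Re z ^+ 2 + Im z ^+ 2)).
Proof. by case: z. Qed.
Lemma Re_real a : Re a%:C = a. Proof. by []. Qed.
Lemma Im_real a : Im a%:C = 0. Proof. by []. Qed.

Definition cis t : R[i] := cos t +i* sin t.

Lemma Re_mk a b : Re (a +i* b) = a. Proof. by []. Qed.
Lemma Im_mk a b : Im (a +i* b) = b. Proof. by []. Qed.
Lemma Re_cis t : Re (cis t) = cos t. Proof. by []. Qed.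
Lemma Im_cis t : Im (cis t) = sin t. Proof. by []. Qed.

Definition ReImE := (Re_add, Im_add, Re_opp, Im_opp, Re_mul, Im_mul, Re_real, Im_real,
  Re_cis, Im_cis, Re_mk, Im_mk).

Lemma normc_ge0 z : 0 <= normc z.
Proof. by case: z => a b /=; exact: sqrtr_ge0. Qed.

Lemma normc_sqr z : normc z ^+ 2 = Re z ^+ 2 + Im z ^+ 2.
Proof. by case: z => a b /=; rewrite sqr_sqrtr// addr_ge0// sqr_ge0. Qed.

Lemma normc_gt0 z : (0 < normc z) = (z != 0).
Proof.
rewrite lt_neqAle normc_ge0 andbT eq_sym; congr (~~ _).
by apply/eqP/eqP => [/eq0_normc//|->]; exact: normc0.
Qed.

Lemma normc_real a : normc a%:C = `|a|.
Proof. by rewrite /normc/= expr0n addr0 sqrtr_sqr. Qed.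

Lemma normcX z n : normc (z ^+ n) = normc z ^+ n.
Proof. by elim: n => [|n IH]; rewrite ?expr0 ?normc1// !exprS normcM IH. Qed.

Lemma normc_triangle z w : normc (z + w) <= normc z + normc w.
Proof. exact: le_normcD. Qed.

Lemma normc_opp z : normc (- z) = normc z.
Proof. exact: normcN. Qed.

Lemma ler_normr_Re z : `|Re z| <= normc z.
Proof. by case: z => a b /=; rewrite -sqrtr_sqr ler_sqrt ?addr_ge0 ?sqr_ge0// lerDl sqr_ge0. Qed.

Lemma ler_normr_Im z : `|Im z| <= normc z.
Proof. by case: z => a b /=; rewrite -sqrtr_sqr ler_sqrt ?addr_ge0 ?sqr_ge0// lerDr sqr_ge0. Qed.

Lemma normc_le z : normc z <= `|Re z| + `|Im z|.
Proof.
rewrite -(@ler_pXn2r _ 2) ?nnegrE ?normc_ge0 ?addr_ge0// normc_sqr.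
rewrite sqrrD !real_normK ?num_real// -addrAC lerDl mulrn_wge0//.
Qed.

Lemma cis0 : cis 0 = 1. Proof. by rewrite /cis cos0 sin0. Qed.

Lemma cisD a b : cis (a + b) = cis a * cis b.
Proof. by apply: complex_eq; rewrite !ReImE /= ?cosD ?sinD// addrC. Qed.

Lemma normc_cis t : normc (cis t) = 1.
Proof. by rewrite /= cos2Dsin2 sqrtr1. Qed.

Lemma cis_neq0 t : cis t != 0.
Proof. by rewrite -normc_gt0 normc_cis. Qed.

(** A relation rather than a function, because continuous branches leave every fixed interval of
    length 2 pi; two values for the same nonzero [z] are compared by [is_arg_uniq]. *)
Definition is_arg z t := z = (normc z)%:C * cis t.

Lemma is_argM z w a b : is_arg z a -> is_arg w b -> is_arg (z * w) (a + b).
Proof.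
by rewrite /is_arg => {1}-> {1}->; rewrite normcM cisD rmorphM/= mulrACA.
Qed.

Lemma is_arg_cis t : is_arg (cis t) t.
Proof. by rewrite /is_arg normc_cis mul1r. Qed.

Lemma is_argN z t : is_arg z t -> is_arg (- z) (pi + t).
Proof.
rewrite /is_arg normc_opp => {1}->; rewrite cisD -mulrN; congr (_ * _).
by apply: complex_eq; rewrite !ReImE /= cospi sinpi; ring.
Qed.

Lemma is_arg_uniq z a b : z != 0 -> is_arg z a -> is_arg z b -> cis (a - b) = 1.
Proof.
move=> z0 za zb; have n0 : (normc z)%:C != 0.
  by rewrite -[0]/((0 : R)%:C) (inj_eq (@complexI _)) gt_eqF// normc_gt0.
apply: (mulIf (cis_neq0 b)); rewrite -cisD subrK mul1r.
by apply: (mulfI n0); rewrite -za -zb.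
Qed.

(** The principal argument on the open right half-plane, the only place where it is used as an
    argument. *)
Definition aarg z := atan (Im z / Re z).

Lemma aarg_itv z : - (pi / 2) < aarg z < pi / 2.
Proof. by rewrite atan_gtNpi2 atan_ltpi2. Qed.

Lemma is_arg_aarg z : 0 < Re z -> is_arg z (aarg z).
Proof.
move=> z0; have nz : normc z * cos (aarg z) = Re z.
  have -> : normc z = Re z * Num.sqrt (1 + (Im z / Re z) ^+ 2).
    apply/eqP; rewrite -(@eqrXn2 _ 2)//; last 2 first.
    - exact: normc_ge0.
    - by rewrite mulr_ge0 ?sqrtr_ge0// ltW.
    rewrite normc_sqr exprMn sqr_sqrtr ?addr_ge0 ?sqr_ge0//.
    by apply/eqP; field; rewrite gt_eqF.
  rewrite /aarg cos_atan mulfK// gt_eqF// sqrtr_gt0 ltr_pwDl//.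
  exact: sqr_ge0.
have ct : cos (aarg z) != 0 by apply/negP => /eqP ct; move: z0; rewrite -nz ct mulr0 ltxx.
apply: complex_eq; rewrite !ReImE /= mul0r ?subr0 ?addr0//.
have : tan (aarg z) = Im z / Re z by exact: atanK.
rewrite /tan => /(congr1 (fun u => u * Re z)); rewrite divfK ?gt_eqF// => <-.
by rewrite -nz; field.
Qed.

(** From cos t = 1 - 2 sin(t/2)^2. This replaces [cis t = 1] by one real equation, whose roots are
    spaced by 2 pi. *)
Lemma cis_eq1_half t : cis t = 1 -> sin (t / 2) = 0.
Proof.
move=> /(congr1 (@complex.Re R)) /=; have {1}-> : t = t / 2 *+ 2 by rewrite -mulr_natr; field.
rewrite cos_mulr2n => h; apply/eqP; rewrite -sqrf_eq0; apply/eqP.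
by have := cos2Dsin2 (t / 2); lra.
Qed.

Lemma sin_half_neq0 t x : sin (t / 2) = 0 -> t < x -> x < t + 2 * pi -> sin (x / 2) != 0.
Proof.
move=> st tx xt; have -> : x / 2 = t / 2 + (x - t) / 2 by field.
rewrite sinD st mul0r add0r mulf_neq0//.
  apply/negP => /eqP ct; have := cos2Dsin2 (t / 2); rewrite st ct; lra.
by rewrite gt_eqF// sin_gt0_pi//; lra.
Qed.

Lemma cis_eq1_lt t : cis t = 1 -> - (2 * pi) < t < 2 * pi -> t = 0.
Proof.
move=> /cis_eq1_half st /andP[t1 t2]; have [t0|t0|//] := ltgtP t 0.
- by have := sin_half_neq0 st t0; rewrite mul0r sin0 eqxx => /(_ _)/negP; case=> //; lra.
- have : sin (0 / 2) = 0 :> R by rewrite mul0r sin0.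
  by move=> /sin_half_neq0/(_ t0); rewrite add0r => /(_ t2); rewrite st eqxx.
Qed.

(** All values of [F] are multiples of 2 pi. If [F a] and [F b] differed, the intermediate value
    theorem would give a value strictly between two consecutive multiples; the candidate is at most
    [pi] above the smaller end. *)
Lemma cis_eq1_constant (F : R -> R) a b : a <= b ->
  {within `[a, b], continuous F} -> (forall x, a <= x <= b -> cis (F x) = 1) ->
  F a = F b.
Proof.
move=> ab cF F1; have pi0 := pi_gt0 R.
have half x : a <= x <= b -> sin (F x / 2) = 0 by move=> /F1/cis_eq1_half.
have key u v v' : sin (u / 2) = 0 -> u < v' -> Num.min (F a) (F b) = u ->
    Num.max (F a) (F b) = v' -> v = Num.min v' (u + pi) -> False.
  move=> su uv mu mv vE; have [uv1 vv'] : u < v /\ v <= v'.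
    by rewrite vE lt_min uv ltrDl pi0 ge_min lexx.
  have [] := @IVT _ F a b v ab cF; first by rewrite mu mv (ltW uv1).
  move=> c; rewrite in_itv/= => cab Fc.
  have : v < u + 2 * pi by rewrite vE gt_min; apply/orP; right; lra.
  by move=> /(sin_half_neq0 su uv1); rewrite -Fc half// eqxx.
have aab : a <= a <= b by rewrite lexx.
have bab : a <= b <= b by rewrite lexx andbT.
have [Fab|Fab|//] := ltgtP (F a) (F b); exfalso.
- apply: (key (F a) _ (F b)); rewrite ?half//; [exact: min_l (ltW _)|exact: max_r (ltW _)].
- apply: (key (F b) _ (F a)); rewrite ?half//; [exact: min_r (ltW _)|exact: max_l (ltW _)].
Qed.

End complex_arguments.

(** * Continuity of complex-valued functions *)

Lemma continuous_ext (T U : topologicalType) (f g : T -> U) (x : T) :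
  f =1 g -> {for x, continuous f} -> {for x, continuous g}.
Proof. by move=> /funext ->. Qed.

Section componentwise_continuity.
Variable (R : realType).

(** Continuity of both components, so that every argument reduces to real-valued functions. *)
Definition ccont (T : topologicalType) (f : T -> R[i]) (x : T) :=
  {for x, continuous (fun y => Re (f y))} /\ {for x, continuous (fun y => Im (f y))}.

Variable T : topologicalType.
Implicit Types (f g : T -> R[i]) (x : T).

Lemma ccont_cst c x : ccont (fun=> c) x.
Proof. by split; exact: cst_continuous. Qed.

Lemma ccontD f g x : ccont f x -> ccont g x -> ccont (fun y => f y + g y) x.
Proof.
move=> [fr fi] [gr gi]; split.
- by apply: (continuous_ext (fun y => esym (Re_add _ _))); exact: continuousD.
- by apply: (continuous_ext (fun y => esym (Im_add _ _))); exact: continuousD.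
Qed.

Lemma ccontN f x : ccont f x -> ccont (fun y => - f y) x.
Proof.
move=> [fr fi]; split.
- by apply: (continuous_ext (fun y => esym (Re_opp _))); exact: continuousN.
- by apply: (continuous_ext (fun y => esym (Im_opp _))); exact: continuousN.
Qed.

Lemma ccontB f g x : ccont f x -> ccont g x -> ccont (fun y => f y - g y) x.
Proof. by move=> fx /ccontN; exact: ccontD. Qed.

Lemma ccontM f g x : ccont f x -> ccont g x -> ccont (fun y => f y * g y) x.
Proof.
move=> [fr fi] [gr gi]; split.
- apply: (continuous_ext (fun y => esym (Re_mul _ _))).
  by apply: continuousB; exact: continuousM.
- apply: (continuous_ext (fun y => esym (Im_mul _ _))).
  by apply: continuousD; exact: continuousM.
Qed.

Lemma ccontV f x : f x != 0 -> ccont f x -> ccont (fun y => (f y)^-1) x.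
Proof.
move=> f0 [fr fi].
have n0 : Re (f x) ^+ 2 + Im (f x) ^+ 2 != 0.
  by rewrite -normc_sqr expf_neq0// gt_eqF// normc_gt0.
have nV : {for x, continuous (fun y => (Re (f y) ^+ 2 + Im (f y) ^+ 2)^-1)}.
  by apply: continuousV => //; apply: continuousD; exact: continuousM.
split.
- by apply: (continuous_ext (fun y => esym (Re_inv _))); exact: continuousM.
- apply: (continuous_ext (fun y => esym (Im_inv _))).
  by apply: continuousN; exact: continuousM.
Qed.

Lemma ccont_prod (I : Type) (s : seq I) (F : I -> T -> R[i]) x :
  (forall i, ccont (F i) x) -> ccont (fun y => \prod_(i <- s) F i y) x.
Proof.
move=> cF; elim: s => [|i s IH].
  by under eq_fun do rewrite big_nil; exact: ccont_cst.
by under eq_fun do rewrite big_cons; exact: ccontM.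
Qed.

Lemma ccont_aarg f x : 0 < Re (f x) -> ccont f x ->
  {for x, continuous (fun y => aarg (f y))}.
Proof.
move=> f0 [fr fi]; apply: (@continuous_comp _ _ _ (fun y => Im (f y) / Re (f y)) atan).
  by apply: continuousM => //; apply: continuousV => //; rewrite gt_eqF.
exact: continuous_atan.
Qed.

Lemma continuous_sum (I : Type) (s : seq I) (F : I -> T -> R) x :
  (forall i, {for x, continuous (F i)}) ->
  {for x, continuous (fun y => \sum_(i <- s) F i y)}.
Proof.
move=> cF; elim: s => [|i s IH].
  by apply: (continuous_ext (fun y => esym (big_nil _ _ _ _))); exact: cst_continuous.
by apply: (continuous_ext (fun y => esym (big_cons _ _ _ _ _ _))); exact: continuousD.
Qed.

End componentwise_continuity.

(** * Taylor expansions and multiplicities of zeros *)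

Section local_taylor.
Variable K : numFieldType.
Implicit Types (f : K -> K) (D : nat -> K -> K) (z w : K).

(* [D n] is the [n]-th derivative of [D 0]; stated with Taylor remainders so that the
   real and the complex derivatives are treated at once. *)
Definition local_taylor D := forall m n z, exists C, forall w, `|w| <= 1 ->
  `|D m (z + w) - \sum_(j < n) D (m + j)%N z * w ^+ j / j`!%:R| <= C * `|w| ^+ n.

Lemma is_derive_of_quadratic_error f z l C :
  (forall w, `|w| <= 1 -> `|f (z + w) - f z - l * w| <= C * `|w| ^+ 2) ->
  is_derive z 1 f l.
Proof.
move=> H; have C0 : 0 <= C.
  by have := H 1; rewrite normr1 expr1n !mulr1 => /(_ (lexx _))/(le_trans (normr_ge0 _)).
suff fl : h^-1 *: (f (h *: (1 : K) + z) - f z) @[h --> 0^'] --> l.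
  by apply: DeriveDef; [apply/cvg_ex; exists l|exact: cvg_lim].
apply/cvgrPdist_le => e e0; near=> h.
have h1 : `|h| <= 1 by near: h; exact: dnbhs0_le.
have hn : h != 0 by near: h; exact: nbhs_dnbhs_neq.
(* [C + 1] rather than [C], which may be [0]. *)
have hC : `|h| <= e / (C + 1).
  by near: h; apply: dnbhs0_le; rewrite divr_gt0// ltr_wpDl.
have -> : l - h^-1 *: (f (h *: (1 : K) + z) - f z) = - (h^-1 * (f (z + h) - f z - l * h)).
  by rewrite /GRing.scale/= mulr1 (addrC h); field.
rewrite normrN normrM normrV ?unitfE//.
have h0 : 0 < `|h| by rewrite normr_gt0.
rewrite mulrC ler_pdivrMr//; apply: (le_trans (H h h1)).
rewrite expr2 mulrA ler_wpM2r//.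
apply: (le_trans (ler_wpM2l _ hC)) => //.
rewrite mulrC -mulrA ler_piMr ?(ltW e0)// mulrC ler_pdivrMr ?ltr_wpDl// mul1r lerDl.
exact: ler01.
Unshelve. all: by end_near. Qed.

Lemma local_taylor_derive1n D : local_taylor D ->
  forall n, ((D 0)^`(n))%classic = D n.
Proof.
move=> TD; elim=> [|n IH]; first by [].
rewrite derive1nS IH; apply/funext => z.
have [C HC] := TD n 2 z; rewrite derive1E.
suff H : is_derive z 1 (D n) (D n.+1 z) by rewrite derive_val.
apply: (@is_derive_of_quadratic_error _ _ _ C) => w /HC.
rewrite big_ord_recr big_ord1/= addn0 addn1 expr0 fact0 mulr1 divr1 expr1.
by rewrite factS fact0 muln1 divr1 opprD addrA.
Qed.

Lemma zero_mult_neq0 f z : zero_mult f z 0 -> f z != 0.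
Proof. by move=> []. Qed.

Lemma zero_mult_exists D z : local_taylor D -> (exists n, D n z != 0) ->
  exists k, zero_mult (D 0) z k.
Proof.
move=> TD /ex_minnP[k Dk kmin]; exists k; split.
- move=> j jk; rewrite local_taylor_derive1n//; apply/eqP/negPn/negP => /kmin.
  by rewrite leqNgt jk.
- by rewrite local_taylor_derive1n.
Qed.

Lemma zero_mult_leading D z k : local_taylor D -> zero_mult (D 0) z k ->
  D k z != 0 /\ exists C, 0 <= C /\ forall w, `|w| <= 1 ->
  `|D 0 (z + w) - D k z / k`!%:R * w ^+ k| <= C * `|w| ^+ k.+1.
Proof.
move=> TD [H0 Hk]; rewrite local_taylor_derive1n// in Hk; split => //.
have [C HC] := TD 0 k.+1 z; exists C; split.
  by have := HC 1; rewrite normr1 expr1n !mulr1 => /(_ (lexx _))/(le_trans (normr_ge0 _)).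
move=> w /HC; rewrite big_ord_recr/= big1 ?add0r; last first.
  by move=> j _; rewrite -(local_taylor_derive1n TD j) H0 ?ltn_ord// !mul0r.
by rewrite mulrAC.
Qed.

(** Near [z] the leading Taylor term, of modulus [a |w|^k], exceeds the remainder [C |w|^(k+1)]. The
    radius [a / (C + a + 1)] ensures both [|w| <= 1] and [C |w| < a]. *)
Lemma zero_isolated D z : local_taylor D -> (exists n, D n z != 0) ->
  exists2 e, 0 < e & forall w, 0 < `|w| -> `|w| < e -> D 0 (z + w) != 0.
Proof.
move=> TD /(zero_mult_exists TD)[k /(zero_mult_leading TD)[Dk [C [C0 HC]]]].
set a := `|D k z / k`!%:R|.
have a0 : 0 < a by rewrite normr_gt0 mulf_neq0// invr_eq0 pnatr_eq0 -lt0n fact_gt0.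
have d0 : 0 < C + a + 1 by rewrite ltr_wpDl// addr_ge0// ltW.
exists (a / (C + a + 1)); first by rewrite divr_gt0.
move=> w w0 we; apply/eqP => Dw.
have w1 : `|w| <= 1.
  apply: (le_trans (ltW we)); rewrite ler_pdivrMr// mul1r -addrA addrCA lerDl.
  by rewrite addr_ge0.
have := HC w w1; rewrite Dw sub0r normrN normrM normrX exprS mulrA.
rewrite ler_pM2r ?exprn_gt0//= -/a => aC.
have : `|w| * (C + a + 1) < a by rewrite -ltr_pdivlMr.
move=> /lt_le_trans/(_ aC); rewrite mulrC ltr_pM2r// -addrA gtrDl.
by rewrite lt_gtF// ltr_wpDl// ltW.
Qed.

Lemma lists_zeros_exists D (A : set K) : local_taylor D ->
  finite_set [set z | A z /\ D 0 z = 0] ->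
  (forall z, A z -> exists n, D n z != 0) ->
  exists s, lists_zeros (D 0) A s.
Proof.
move=> TD /finite_seqP[s sE] An.
(* Outside [A] the value [0] is a placeholder: all points of [s] are in [A]. *)
have /choice[k kP] z : exists k, A z -> zero_mult (D 0) z k.
  have [Az|nAz] := pselect (A z); last by exists 0%N.
  by have [k] := zero_mult_exists TD (An z Az); exists k.
have memsE z : z \in s -> A z /\ D 0 z = 0.
  by move=> zs; have : [set` s] z by []; rewrite -sE.
exists (flatten [seq nseq (k z) z | z <- undup s]); split.
  move=> z /flattenP[t /mapP[y]]; rewrite mem_undup => ys ->.
  by rewrite mem_nseq => /andP[_ /eqP->]; exact: (memsE y ys).1.
move=> z Az; suff -> : count_mem z (flatten [seq nseq (k z) z | z <- undup s]) = k z.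
  exact: kP.
have -> : count_mem z (flatten [seq nseq (k z0) z0 | z0 <- undup s]) =
    if z \in undup s then k z else 0%N.
  elim: (undup s) (undup_uniq s) => [|y t IH]//= /andP[yt ut].
  rewrite count_cat IH// count_nseq/= in_cons [z == y]eq_sym.
  by case: eqVneq yt => [->|_] yt; rewrite ?(negbTE yt) ?mul1n ?addn0 ?mul0n.
rewrite mem_undup; case: ifPn => // zs.
have := kP z Az; case: (k z) => // m [/(_ 0%N isT) D0 _]; exfalso.
have : [set` s] z by rewrite -sE; split.
by rewrite /= (negbTE zs).
Qed.

End local_taylor.

(** Each point of [A] has an open neighbourhood that meets [Z] at most in its centre. The centres of
    a finite subcover then contain all of [A] intersected with [Z]. *)
Lemma finite_set_compact_discrete (T : ptopologicalType) (A Z : set T) :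
  compact A -> (forall x, A x -> \forall y \near x, Z y -> y = x) ->
  finite_set (A `&` Z).
Proof.
move=> cA H.
have /choice[f fP] x : exists n : set T, A x -> open n /\ n x /\ n `&` Z `<=` [set x].
  have [Ax|nAx] := pselect (A x); last by exists set0.
  have := H x Ax; rewrite /prop_near1 nbhsE => -[n [on nx] nZ]; exists n => _; split => //.
  by split => // y [/nZ].
have := cA; rewrite compact_cover => /(_ T A f (fun i Ai => (fP i Ai).1)) [].
  by move=> x Ax; exists x => //; have [_ []] := fP x Ax.
move=> D DA AD; apply: (sub_finite_set _ (finite_fset D)).
  move=> x [Ax Zx]; have [i iD fxi] := AD x Ax.
  have [_ [_ fiZ]] := fP i (set_mem (DA _ iD)); by have -> : x = i := fiZ x (conj fxi Zx).
Qed.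

(** * Crossings of the imaginary axis *)

Section crossings.
Variable R : realType.
Implicit Types (x y t a b : R) (k q : int) (rho : seq R).

Local Notation mpi k := (k%:~R * (pi : R)).

Lemma sin_mpi k : sin (mpi k) = 0.
Proof.
elim/int_rect: k => [|n IH|n IH]; first by rewrite mul0r sin0.
- by rewrite intS intrD mulrDl mul1r addrC sinDpi IH oppr0.
- have := sinDpi (mpi (- n.+1%:Z)).
  have -> : mpi (- n.+1%:Z) + pi = mpi (- n%:Z).
    by rewrite intS opprD rmorphD/= mulrDl mulN1r addrAC addNr add0r.
  by rewrite IH => /eqP; rewrite eq_sym oppr_eq0 => /eqP.
Qed.

Lemma mpiS k : mpi (k + 1) = mpi k + pi.
Proof. by rewrite intrD mulrDl mulr1z mul1r. Qed.

Lemma cos_mpiS k : cos (mpi (k + 1)) = - cos (mpi k).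
Proof. by rewrite mpiS cosDpi. Qed.

Lemma cos_mpi_sqr k : cos (mpi k) * cos (mpi k) = 1.
Proof. by have := cos2Dsin2 (mpi k); rewrite sin_mpi expr0n addr0 expr2. Qed.

Lemma sgr_cos_mpi k : Num.sg (cos (mpi k)) = cos (mpi k).
Proof.
have /eqP := cos_mpi_sqr k; rewrite -expr2 sqrf_eq1 => /orP[]/eqP->.
  by rewrite sgr1.
by rewrite sgrN1.
Qed.

(** The inequality is strict, so a [k] exists exactly when [cos t] is nonzero, that is, when the
    curve is off the imaginary axis; it is then unique. *)
Definition nearest_mpi t k := `|t - mpi k| < pi / 2.

Lemma cos_subr_mpi t k : cos t = cos (t - mpi k) * cos (mpi k).
Proof. by rewrite -[in LHS](subrK (mpi k) t) [LHS]cosD sin_mpi mulr0 subr0. Qed.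

Lemma sin_subr_mpi t k : sin t = sin (t - mpi k) * cos (mpi k).
Proof. by rewrite -[in LHS](subrK (mpi k) t) [LHS]sinD sin_mpi mulr0 addr0. Qed.

Lemma sgr_cos_nearest t k : nearest_mpi t k -> Num.sg (cos t) = cos (mpi k).
Proof.
rewrite /nearest_mpi ltr_norml => tk.
by rewrite (cos_subr_mpi t k) sgrM sgr_cos_mpi gtr0_sg ?mul1r// cos_gt0_pihalf.
Qed.

Lemma nearest_mpi_uniq t k q : nearest_mpi t k -> nearest_mpi t q -> k = q.
Proof.
rewrite /nearest_mpi => tk tq; have pi0 := pi_gt0 R.
have : `|mpi k - mpi q| < pi.
  have -> : mpi k - mpi q = (t - mpi q) - (t - mpi k) by ring.
  by apply: (le_lt_trans (ler_normB _ _)); lra.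
rewrite -mulrBl normrM (gtr0_norm pi0) gtr_pMl// -intrB -intr_norm.
by rewrite -[1]/(1%:~R) ltr_int -[1]add0r ltzD1 normr_le0 subr_eq0 => /eqP.
Qed.

Lemma floor_mpi t : exists k, mpi k <= t < mpi k + pi.
Proof.
have pi0 := pi_gt0 R; exists (Num.floor (t / pi)).
have /andP[h1 h2] := floor_itv (t / pi).
rewrite -ler_pdivlMr// h1/=; move: h2; rewrite intrD ltr_pdivrMr//.
by rewrite mulrDl mul1r.
Qed.

Lemma cos_eq0_mpi t : cos t = 0 -> exists k, t = mpi k + pi / 2.
Proof.
move=> ct; have pi0 := pi_gt0 R; have [k /andP[kt tk]] := floor_mpi t; exists k.
have c0 : cos (t - mpi k) = 0.
  apply/eqP; have /eqP := ct; rewrite (cos_subr_mpi t k) mulf_eq0 => /orP[//|/eqP c0].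
  by have := cos_mpi_sqr k; rewrite c0 mul0r => /esym/eqP; rewrite oner_eq0.
have [h|h|<-] := ltgtP (t - mpi k) (pi / 2); last by ring.
- have : 0 < cos (t - mpi k) by apply: cos_gt0_pihalf; lra.
  by rewrite c0 ltxx.
- have : 0 < sin (t - mpi k - pi / 2) by apply: sin_gt0_pi; lra.
  by rewrite sinBpihalf c0 oppr0 ltxx.
Qed.

Lemma cos_mpi_pihalf k : cos (mpi k + pi / 2) = 0.
Proof. by rewrite cosDpihalf sin_mpi oppr0. Qed.

Lemma nearest_mpi_ex t : cos t != 0 -> exists k, nearest_mpi t k.
Proof.
move=> ct; have [k /andP[kt tk]] := floor_mpi t; have pi0 := pi_gt0 R.
have [h|h|h] := ltgtP t (mpi k + pi / 2).
- by exists k; rewrite /nearest_mpi ltr_norml; lra.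
- exists (k + 1); rewrite /nearest_mpi ltr_norml mpiS; lra.
- by move: ct; rewrite h cos_mpi_pihalf eqxx.
Qed.

(** To get away from [mpi k], [phi] would have to cross [mpi k + pi / 2] or [mpi (k - 1) + pi / 2],
    where the cosine vanishes. *)
Lemma nearest_mpi_constant (phi : R -> R) a b k : a <= b ->
  (forall x, a <= x <= b -> {for x, continuous phi}) ->
  (forall x, a <= x <= b -> cos (phi x) != 0) ->
  nearest_mpi (phi a) k -> nearest_mpi (phi b) k.
Proof.
move=> ab cphi c0 ak; have pi0 := pi_gt0 R.
have cw : {within `[a, b], continuous phi}.
  by apply: continuous_in_subspaceT => x; rewrite inE/= in_itv/=; exact: cphi.
have avoid q : ~ (Num.min (phi a) (phi b) <= mpi q + pi / 2 <= Num.max (phi a) (phi b)).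
  move=> /(IVT ab cw)[c]; rewrite in_itv/= => /c0 + phic.
  by rewrite phic cos_mpi_pihalf eqxx.
move: ak; rewrite /nearest_mpi !ltr_norml => /andP[h1 h2]; apply/andP; split.
- rewrite ltNge; apply/negP => h; apply: (avoid (k - 1)).
  have := mpiS (k - 1); rewrite subrK => mpiK; rewrite ge_min le_max.
  by apply/andP; split; apply/orP; [right|left]; lra.
- rewrite ltNge; apply/negP => h; apply: (avoid k).
  by rewrite ge_min le_max; apply/andP; split; apply/orP; [left|right]; lra.
Qed.

Definition alternating_sg (S : R -> R) rho :=
  \sum_(j < size rho) (-1) ^+ j * Num.sg (S rho`_j).

(** Equal consecutive terms cancel in pairs: a zero of even multiplicity contributes nothing and
    leaves the later signs unchanged. *)
Lemma alternating_sg_nseq_cat S p t rho :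
  alternating_sg S (nseq p t ++ rho) =
  (odd p)%:R * Num.sg (S t) + (-1) ^+ p * alternating_sg S rho.
Proof.
elim: p => [|p IH]; first by rewrite mul0r add0r expr0 mul1r.
rewrite /alternating_sg/= big_ord_recl/= expr0 mul1r.
under eq_bigr => i _ do rewrite /bump/= add1n exprS mulN1r mulNr.
rewrite sumrN -/(alternating_sg S (nseq p t ++ rho)) -/(alternating_sg S rho) IH exprS.
by case: (odd p) => /=; ring.
Qed.

Lemma sorted_ge_block t rho : sorted >=%R (t :: rho) ->
  exists p s, [/\ t :: rho = nseq p.+1 t ++ s, sorted >=%R s & all (< t) s].
Proof.
elim: rho => [|y rho IH] /= => [_|/andP[yt yrho]]; first by exists 0%N, [::].
have [yE|yt'] := eqVneq y t.
  by move: yrho; rewrite yE => /IH[p [s [e ss st]]]; exists p.+1, s; rewrite e.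
exists 0%N, (y :: rho); split => //=.
have lt_yt : y < t by rewrite lt_neqAle yt' yt.
rewrite lt_yt/=; apply/allP => z zr.
by have /allP/(_ z zr)/= /le_lt_trans := order_path_min (@ge_trans _ _) yrho; exact.
Qed.

Lemma neq_opp_of_sqr1 (a : R) : a * a = 1 -> a != - a.
Proof.
move=> a1; apply/eqP => aE; have a0 : a = 0 by lra.
by move: a1; rewrite a0 mul0r => /esym/eqP; rewrite oner_eq0.
Qed.

(** Here [c] stands for [cos (mpi q)], and [cx], [cy] for the cosines at [mpi kx], [mpi ky]. When
    [o] is even the two cosines agree and so do the indices; when [o] is odd one index is [q], the
    other [q + 1], and [cy] tells which. *)
Lemma jump_of_signs (c cx cy : R) kx ky q (o : bool) : c * c = 1 ->
  (kx = q /\ cx = c) \/ (kx = q + 1 /\ cx = - c) ->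
  (ky = q /\ cy = c) \/ (ky = q + 1 /\ cy = - c) ->
  cx = (-1) ^+ o * cy -> (kx - ky)%:~R = cy * (o%:R * c).
Proof.
move=> c1; have /negbTE cN := neq_opp_of_sqr1 c1.
move=> [] [-> ->] [] [-> ->]; case: o; rewrite ?expr1 ?expr0 ?mulN1r ?mul1r ?opprK => /eqP;
  rewrite ?cN 1?eq_sym ?cN// => _.
- by rewrite subrr mul0r mulr0.
- by rewrite opprD addrA subrr add0r mulrNz mulr1z mulNr c1.
- by rewrite addrAC subrr add0r mulr1z c1.
- by rewrite subrr mul0r mulr0.
Qed.

Definition sgr_like_power (M : R -> R) t p := exists2 e, 0 < e &
  exists c, forall x, 0 < `|x - t| < e -> Num.sg (M x) = c * Num.sg (x - t) ^+ p.

Variables (M S amp phi : R -> R).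

(** At [t] the argument is [mpi q + pi / 2] for some [q], so close to [t] the nearest multiple has
    index [q] or [q + 1], according to the side on which [phi] lies. The sign of [S t] is
    [cos (mpi q)], and the sign of [M] on each side is the cosine at the nearest multiple there. *)
Lemma nearest_mpi_jump t p (amp_gt0 : forall x, 0 < amp x)
  (ME : \forall x \near t, M x = amp x * cos (phi x)) :
  S t = amp t * sin (phi t) ->
  {for t, continuous phi} -> M t = 0 -> sgr_like_power M t p ->
  exists2 e, 0 < e & forall x y kx ky, t - e < x < t -> t < y < t + e ->
    nearest_mpi (phi x) kx -> nearest_mpi (phi y) ky ->
    Num.sg (M x) = (-1) ^+ p * Num.sg (M y) /\
    (kx - ky)%:~R = Num.sg (M y) * ((odd p)%:R * Num.sg (S t)).
Proof.
move=> SE cphi Mt [e1 e10 [c Hc]]; have pi0 := pi_gt0 R.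
have ct : cos (phi t) = 0.
  apply/eqP; have /eqP := nbhs_singleton ME; rewrite Mt eq_sym mulf_eq0.
  by rewrite gt_eqF.
have [q phit] := cos_eq0_mpi ct.
have St : Num.sg (S t) = cos (mpi q).
  by rewrite SE sgrM gtr0_sg// mul1r phit sinDpihalf sgr_cos_mpi.
have : \forall x \near t, M x = amp x * cos (phi x) /\ `|phi t - phi x| < pi / 2.
  near=> x; split; first by near: x.
  by near: x; move/cvgrPdist_lt : cphi; apply; rewrite divr_gt0.
move=> /nbhs_ballP[e2 /= e20 He2].
have He x : `|t - x| < e2 -> M x = amp x * cos (phi x) /\ `|phi t - phi x| < pi / 2.
  by move=> xe; exact: He2.
exists (Num.min e1 e2); first by rewrite lt_min e10 e20.
move=> x y kx ky /andP[x1 x2] /andP[y1 y2] nx ny.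
have [xe1 xe2] : t - e1 < x /\ t - e2 < x.
  by move: x1; rewrite ltrBlDr -ltrBlDl lt_min => /andP[]; lra.
have [ye1 ye2] : y < t + e1 /\ y < t + e2.
  by move: y2; rewrite -ltrBlDl lt_min => /andP[]; lra.
have sgMx : Num.sg (M x) = c * (-1) ^+ p.
  rewrite Hc ?ltr0_sg ?subr_lt0// ltr0_norm ?subr_lt0//; apply/andP; split; lra.
have sgMy : Num.sg (M y) = c.
  rewrite Hc ?gtr0_sg ?subr_gt0// ?expr1n ?mulr1// gtr0_norm ?subr_gt0//; apply/andP; split; lra.
have near_q z kz : `|t - z| < e2 -> nearest_mpi (phi z) kz ->
    Num.sg (M z) = cos (mpi kz) /\ (kz = q \/ kz = q + 1).
  move=> /He[-> dz] nz; rewrite sgrM gtr0_sg// mul1r (sgr_cos_nearest nz); split => //.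
  have [h|h] := ltP (phi z) (phi t).
    by left; apply: (nearest_mpi_uniq nz); move: dz; rewrite /nearest_mpi !ltr_norml phit; lra.
  right; apply: (nearest_mpi_uniq nz); have hne : phi z != phi t.
    apply/eqP => hz; have := sgr_cos_nearest nz; rewrite hz ct sgr0 => h0.
    by have := cos_mpi_sqr kz; rewrite -h0 mul0r => /esym/eqP; rewrite oner_eq0.
  have {h hne} : phi t < phi z by rewrite lt_neqAle eq_sym hne.
  move: dz; rewrite /nearest_mpi !ltr_norml phit mpiS; lra.
have [sx kxq] : Num.sg (M x) = cos (mpi kx) /\ (kx = q \/ kx = q + 1).
  by apply: near_q nx; rewrite ger0_norm; lra.
have [sy kyq] : Num.sg (M y) = cos (mpi ky) /\ (ky = q \/ ky = q + 1).
  by apply: near_q ny; rewrite ler0_norm; lra.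
have sxy : Num.sg (M x) = (-1) ^+ p * Num.sg (M y) by rewrite sgMx sgMy mulrC.
split => //; rewrite St; move: sxy; rewrite sx sy -signr_odd => sxy.
apply: (jump_of_signs (cos_mpi_sqr q) _ _ sxy).
- by case: kxq => ->; [left|right]; rewrite ?cos_mpiS.
- by case: kyq => ->; [left|right]; rewrite ?cos_mpiS.
Unshelve. all: by end_near. Qed.

End crossings.

Section crossing_count.
Variable R : realType.
Local Notation mpi k := (k%:~R * (pi : R)).
Variables (M S amp phi : R -> R) (W : R).
Hypotheses (amp_gt0 : forall x, 0 < amp x)
  (ME : forall x, 0 <= x <= W -> M x = amp x * cos (phi x))
  (SE : forall x, 0 <= x <= W -> S x = amp x * sin (phi x))
  (cphi : forall x, 0 <= x <= W -> {for x, continuous phi})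
  (Mpow : forall t p, zero_mult M t p -> sgr_like_power M t p)
  (M0 : M 0 != 0).

Let cos_neq0 x : 0 <= x <= W -> M x != 0 -> cos (phi x) != 0.
Proof. by move=> xW; rewrite ME// mulf_eq0 negb_or => /andP[]. Qed.

(* Induction on the distinct zeros of [M] from the largest one down: below a zero of
   multiplicity [p] the sign of [M] is multiplied by [(-1) ^ p], and the nearest multiple of
   [pi] changes only if [p] is odd, by a step which the sign of [S] determines. *)
Lemma crossing_count n rho b k0 kb : (size rho <= n)%N -> sorted >=%R rho ->
  0 < b <= W -> M b != 0 ->
  (forall t, t \in rho -> 0 < t < b) ->
  (forall t, 0 < t < b -> zero_mult M t (count_mem t rho)) ->
  nearest_mpi (phi 0) k0 -> nearest_mpi (phi b) kb ->
  (k0 - kb)%:~R = Num.sg (M b) * alternating_sg S rho.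
Proof.
elim: n rho b kb => [|n IH] [|t rho] b kb // => [_ _|sn srho|sn srho]
  /andP[b0 bW] Mb rho_lt zrho near0 nearb.
(* Both cases of an empty list: [M] has no zero on [[0, b]], so the nearest multiple does not
   change. *)
1,2: rewrite /alternating_sg big_ord0 mulr0.
1,2: have Mn0 x : 0 <= x <= b -> M x != 0.
1,3: move=> /andP[]; rewrite le_eqVlt => /orP[/eqP<-//|x0].
1,2: rewrite le_eqVlt => /orP[/eqP->//|xb].
1,2: by apply: zero_mult_neq0; apply: (zrho x); rewrite x0 xb.
1,2: suff -> : k0 = kb by rewrite subrr.
1,2: apply: nearest_mpi_uniq nearb; apply: (nearest_mpi_constant (ltW b0)) near0 => x /andP[x0 xb].
1,3: by apply: cphi; rewrite x0 (le_trans xb).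
1,2: by apply: cos_neq0; rewrite ?Mn0 ?x0 ?xb// (le_trans xb).
have [p [s [rhoE ss st]]] := sorted_ge_block srho.
have /andP[t0 tb] : 0 < t < b by apply: rho_lt; rewrite mem_head.
have tW : 0 <= t <= W by rewrite !ltW// (lt_le_trans tb).
have st' z : z \in s -> z < t by move=> /(allP st).
have cnt z : count_mem z (t :: rho) = ((t == z) * p.+1 + count_mem z s)%N.
  by rewrite rhoE count_cat count_nseq.
have ts : count_mem t s = 0%N.
  by apply/count_memPn/negP => /st'; rewrite ltxx.
have zt := zrho t; rewrite t0 tb cnt eqxx mul1n ts addn0 in zt.
have {}zt := zt isT; have Mt : M t = 0.  by have [/(_ 0%N isT)] := zt.
have Mn : \forall x \near t, M x = amp x * cos (phi x).
  near=> x; apply: ME; have : x \in `]0, b[ by near: x; apply: near_in_itvoo; rewrite in_itv/= t0.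
  by rewrite in_itv/= => /andP[/ltW-> /ltW xb]; exact: le_trans bW.
have [e e0 He] := nearest_mpi_jump amp_gt0 Mn (SE tW) (cphi tW) Mt (Mpow zt).
(* [h] is the next smaller zero, or [0] if there is none. *)
have [h [h0 ht hs]] : exists h, [/\ 0 <= h, h < t & forall z, z \in s -> z <= h].
  case: (s) ss st rhoE => [|y u] yu /allP ut rhoE; first by exists 0.
  exists y; split; [|by apply: ut; rewrite mem_head|].
    have : y \in t :: rho by rewrite rhoE mem_cat mem_head orbT.
    by move=> /rho_lt /andP[/ltW].
  move=> z; rewrite in_cons => /orP[/eqP->//|].
  by have /allP/(_ z) := order_path_min (@ge_trans _ _) yu.
(* Sample points on either side of [t], within the radius [e] of the jump: no zero lies between [x]
   and [t], nor between [t] and [y]. *)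
pose x := (Num.max h (t - e) + t) / 2.
pose y := (t + Num.min b (t + e)) / 2.
have [hx xt ex] : [/\ h < x, x < t & t - e < x].
  have : Num.max h (t - e) < t by rewrite gt_max ht gtrBl e0.
  by have := le_max h h (t - e); have := le_max (t - e) h (t - e); rewrite !lexx orbT /x; split; lra.
have [ty yb ye] : [/\ t < y, y < b & y < t + e].
  have : t < Num.min b (t + e) by rewrite lt_min tb ltrDl e0.
  by have := ge_min b b (t + e); have := ge_min (t + e) b (t + e); rewrite !lexx orbT /y; split; lra.
have Mxn : M x != 0.
  apply: zero_mult_neq0; have := zrho x; rewrite cnt gt_eqF//= mul0n.
  have -> : count_mem x s = 0%N by apply/count_memPn/negP => /hs; rewrite leNgt hx.
  by apply; rewrite (le_lt_trans h0 hx) (lt_trans xt).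
have Myn z : y <= z <= b -> M z != 0.
  move=> /andP[yz]; rewrite le_eqVlt => /orP[/eqP->//|zb].
  apply: zero_mult_neq0; have := zrho z; have tz : t < z by exact: lt_le_trans yz.
  rewrite cnt lt_eqF//= mul0n.
  have -> : count_mem z s = 0%N by apply/count_memPn/negP => /st'; rewrite ltNge (ltW tz).
  by apply; rewrite (lt_trans t0).
have xW : 0 <= x <= W by rewrite (le_trans h0) ?(ltW hx)//= (le_trans (ltW xt)); case/andP: tW.
have yW : 0 <= y <= W by rewrite (le_trans (ltW t0) (ltW ty))/= (le_trans (ltW yb)).
have [kx nx] := nearest_mpi_ex (cos_neq0 xW Mxn).
have My : M y != 0 by apply: Myn; rewrite lexx ltW.
have [ky ny] := nearest_mpi_ex (cos_neq0 yW My).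
have kyb : ky = kb.
  apply: nearest_mpi_uniq nearb; apply: (nearest_mpi_constant (ltW yb)) ny => z /andP[yz zb].
    by apply: cphi; rewrite (le_trans _ yz) ?(le_trans zb)//; case/andP: yW.
  apply: cos_neq0; last by apply: Myn; rewrite yz.
  by rewrite (le_trans _ yz) ?(le_trans zb)//; case/andP: yW.
have sgyb : Num.sg (M y) = Num.sg (M b).
  rewrite ME// sgrM gtr0_sg// mul1r (sgr_cos_nearest ny) kyb.
  by rewrite ME ?bW ?ltW// sgrM gtr0_sg// mul1r (sgr_cos_nearest nearb).
have [||sgx jmp] := He x y kx ky _ _ nx ny; first by rewrite ex.
  by rewrite ty ye.
have sizes : (size s <= n)%N.
  have := sn; rewrite rhoE size_cat size_nseq addSn ltnS => /(leq_trans _); apply.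
  exact: leq_addl.
have := IH s x kx sizes ss _ Mxn _ _ near0 nx.
rewrite sgx rhoE alternating_sg_nseq_cat sgyb => IHs.
(* The induction hypothesis at [x] accounts for the smaller zeros, [jmp] for [t] itself; between [y]
   and [b] nothing changes. *)
have -> : k0 - kb = (kx - ky) + (k0 - kx) by rewrite -kyb; ring.
rewrite rmorphD/= jmp IHs.
- by rewrite sgyb/=; ring.
- by rewrite (le_lt_trans h0 hx); case/andP: xW.
- move=> z zs; rewrite (le_lt_trans (hs z zs) hx) andbT.
  have : z \in t :: rho by rewrite rhoE mem_cat zs orbT.
  by move=> /rho_lt/andP[].
- move=> z /andP[z0 zx]; have zt' : z < t by exact: lt_trans xt.
  have := zrho z; rewrite cnt gt_eqF//= mul0n add0n; apply.
  by rewrite z0 (lt_trans zt').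
Unshelve. all: by end_near. Qed.
End crossing_count.

(** * Lifting the argument over a half-square *)

Section argument_lifting.
Variable R : realType.

(** The plane is handled as [R * R], with its product topology and compact rectangles. *)
Definition pcont (g : R[i] -> R[i]) :=
  forall p : R * R, ccont (fun q : R * R => g (q.1 +i* q.2)) p.

Lemma pcont_comp (g : R[i] -> R[i]) (T : topologicalType) (h : T -> R[i]) x :
  pcont g -> ccont h x -> ccont (fun y => g (h y)) x.
Proof.
move=> cg [hr hi]; have [gr gi] := cg (Re (h x), Im (h x)).
have ch : {for x, continuous (fun y => (Re (h y), Im (h y)))}.
  exact: (cvg_pair hr hi).
have hE y : h y = (Re (h y)) +i* (Im (h y)) by case: (h y).
split.
- apply: (@continuous_ext _ _ (fun y => Re (g (Re (h y) +i* Im (h y))))).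
    by move=> y; rewrite -hE.
  exact: (continuous_comp ch gr).
- apply: (@continuous_ext _ _ (fun y => Im (g (Re (h y) +i* Im (h y))))).
    by move=> y; rewrite -hE.
  exact: (continuous_comp ch gi).
Qed.

Lemma is_arg_exists (z : R[i]) : exists t, is_arg z t.
Proof.
have pos (w : R[i]) : 0 < Re w -> exists t, is_arg w t by exists (aarg w); exact: is_arg_aarg.
have [z0|z0|z0] := ltgtP 0 (Re z); first exact: pos.
  have [|t zt] := pos (- z); first by rewrite Re_opp oppr_gt0.
  by exists (pi + t); rewrite -[z]opprK; exact: is_argN.
have zE : z = (Im z)%:C * cis (pi / 2).
  by apply: complex_eq; rewrite !ReImE cos_pihalf sin_pihalf -?z0; ring.
have Im_arg (w : R[i]) (a : R) : 0 <= a -> w = a%:C * cis (pi / 2) -> is_arg w (pi / 2).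
  by move=> a0 ->; rewrite /is_arg normcM normc_real normc_cis mulr1 ger0_norm.
have [i0|i0] := leP 0 (Im z); first by exists (pi / 2); exact: (Im_arg _ _ i0 zE).
exists (pi + pi / 2); rewrite -[z]opprK; apply: is_argN; apply: (Im_arg _ (- Im z)); first by lra.
by rewrite {1}zE rmorphN/= mulNr.
Qed.

(** On the diagonal the quotient is [1], so its real part is positive on a neighbourhood of each
    [(p, p)]; compactness of [K] makes the size uniform. Only [p] has to stay in [K]. *)
Lemma uniform_quotient_Re_gt0 (g : R[i] -> R[i]) (K : set (R * R)) (d : R) :
  pcont g -> compact K -> (forall p, K p -> g (p.1 +i* p.2) != 0) -> 0 < d ->
  exists n : nat, forall p q : R * R, K p ->
    `|q.1 - p.1| <= d / n.+1%:R -> `|q.2 - p.2| <= d / n.+1%:R ->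
    0 < Re (g (q.1 +i* q.2) / g (p.1 +i* p.2)).
Proof.
move=> cg /compact_near_coveringP/(_ nat \oo
  (fun n p => forall q : R * R, `|q.1 - p.1| <= d / n.+1%:R ->
    `|q.2 - p.2| <= d / n.+1%:R -> 0 < Re (g (q.1 +i* q.2) / g (p.1 +i* p.2)))) cK g0 d0.
have [] := cK _; last by move=> n _ /(_ n (leqnn n)) Hn; exists n => p q Kp; exact: Hn.
move=> p Kp.
have cG : {for (p, p), continuous (fun u : (R * R) * (R * R) =>
    Re (g (u.2.1 +i* u.2.2) / g (u.1.1 +i* u.1.2)))}.
  suff [] : ccont (fun u : (R * R) * (R * R) => g (u.2.1 +i* u.2.2) / g (u.1.1 +i* u.1.2)) (p, p) by [].
  have c1 : {for (p, p), continuous (fun u : (R * R) * (R * R) => u.1)} by exact: cvg_fst.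
  have c2 : {for (p, p), continuous (fun u : (R * R) * (R * R) => u.2)} by exact: cvg_snd.
  have [r1 i1] := cg p.
  apply: ccontM; last apply: ccontV; last 2 first.
  - exact: g0.
  - by split; [exact: (continuous_comp c1 r1)|exact: (continuous_comp c1 i1)].
  - by split; [exact: (continuous_comp c2 r1)|exact: (continuous_comp c2 i1)].
have : \forall u \near (p, p), 0 < Re (g (u.2.1 +i* u.2.2) / g (u.1.1 +i* u.1.2)).
  by apply: (cvgr_gt _ cG); rewrite /= divff ?g0//= ltr01.
move=> /nbhs_ballP[e /= e0 He].
exists (ball p (e / 2), [set n | d / n.+1%:R < e / 2]).
  split; first by apply: nbhsx_ballx; rewrite divr_gt0.
  have := near_infty_natSinv_lt (PosNum (divr_gt0 (divr_gt0 e0 (@ltr0Sn R 1)) d0)).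
  apply: filterS => n /=; rewrite ltr_pdivlMr// mulrC; exact.
move=> [p' n] /= [pp' ne] q q1 q2; apply: (He (p', q)).
have ball_half : ball p e p'.
  by apply: le_ball pp'; lra.
split => //=; split => /=.
- case: pp' => + _; rewrite /ball/= => h; rewrite -[p.1](subrK p'.1) -addrA.
  apply: (le_lt_trans (ler_normD _ _)); rewrite [e]splitr ltrD//.
  by rewrite distrC (le_lt_trans q1).
- case: pp' => _; rewrite /ball/= => h; rewrite -[p.2](subrK p'.2) -addrA.
  apply: (le_lt_trans (ler_normD _ _)); rewrite [e]splitr ltrD//.
  by rewrite distrC (le_lt_trans q2).
Qed.

(** It contains the right half-disc of radius [W], is stable under contraction towards [0], and is a
    product of two compact segments. *)
Definition half_square (W : R) (z : R[i]) := 0 <= Re z <= W /\ - W <= Im z <= W.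

(* Along each ray from 0 the argument is the sum of the arguments of finitely many
   successive quotients, each of which lies in the right half-plane. *)
Lemma argument_lift (g : R[i] -> R[i]) (W : R) : 0 < W -> pcont g ->
  (forall z, half_square W z -> g z != 0) ->
  exists2 theta : R[i] -> R, forall z, half_square W z -> is_arg (g z) (theta z) &
    forall (T : topologicalType) (h : T -> R[i]) x, ccont h x ->
      half_square W (h x) -> {for x, continuous (fun y => theta (h y))}.
Proof.
move=> W0 cg g0; have [a0 ga0] := is_arg_exists (g 0).
pose K := [set` `[0, W]] `*` [set` `[- W, W]].
have KP (p : R * R) : K p <-> half_square W (p.1 +i* p.2).
  by rewrite /K /half_square /setX/= !in_itv.
have cK : compact K by apply: compact_setX; exact: segment_compact.
have [|n Hn] := uniform_quotient_Re_gt0 cg cK _ W0; first by move=> p /KP/g0.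
pose s k (z : R[i]) := (k%:R / n.+1%:R)%:C * z.
pose u k z := g (s k.+1 z) / g (s k z).
have sQ k z : (k <= n.+1)%N -> half_square W z -> half_square W (s k z).
  move=> kn; rewrite /half_square /s; case: z => a b; rewrite !ReImE /= !mul0r subr0 addr0.
  have c0 : 0 <= k%:R / n.+1%:R :> R by rewrite divr_ge0.
  have c1 : k%:R / n.+1%:R <= 1 :> R by rewrite ler_pdivrMr// mul1r ler_nat.
  move: (_ / _) c0 c1 => c c0 c1 [/andP[a1 a2] /andP[b1 b2]].
  split; apply/andP; split; [exact: mulr_ge0| | |]; nra.
have uRe k z : (k <= n)%N -> half_square W z -> 0 < Re (u k z).
  move=> kn Qz; have := Hn (Re (s k z), Im (s k z)) (Re (s k.+1 z), Im (s k.+1 z)).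
  have E w : Re w +i* Im w = w by case: w.
  rewrite /= !E; apply; first by apply/KP; rewrite /= E; apply: sQ => //; exact: leqW.
    rewrite /s; case: z Qz => a b [/andP[a1 a2] _]; rewrite !ReImE /= !mul0r !subr0.
    rewrite -mulrBl -mulrBl -natrB// subSnn mul1r normrM mulrC normrV ?unitfE//.
    by rewrite normr_nat ler_wpM2r ?invr_ge0// ger0_norm.
  rewrite /s; case: z Qz => a b [_ /andP[b1 b2]]; rewrite !ReImE /= !mul0r !addr0.
  rewrite -mulrBl -mulrBl -natrB// subSnn mul1r normrM mulrC normrV ?unitfE//.
  by rewrite normr_nat ler_wpM2r ?invr_ge0// ler_norml b1.
exists (fun z => a0 + \sum_(k <- iota 0 n.+1) aarg (u k z)).
- move=> z Qz.
  suff H m : (m <= n.+1)%N -> is_arg (g (s m z)) (a0 + \sum_(k <- iota 0 m) aarg (u k z)).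
    have := H n.+1 (leqnn _); rewrite /s divff ?pnatr_eq0//.
    by rewrite [1%:C]/(1 : R[i]) mul1r.
  elim: m => [_|m IH mn].
    by rewrite big_nil addr0 /s mul0r [0%:C]/(0 : R[i]) mul0r.
  rewrite -addn1 iotaD big_cat/= big_seq1 add0n addn1 addrA.
  have gm0 : g (s m z) != 0 by apply/g0/sQ => //; exact: ltnW.
  have -> : g (s m.+1 z) = g (s m z) * u m z by rewrite /u mulrC divfK.
  by apply: is_argM; [exact/IH/ltnW|exact/is_arg_aarg/uRe].
(* Only [h x] itself has to lie in the half-square: the formula is total, and each term is
   continuous where the quotient has positive real part. *)
- move=> T h x ch Qx; apply: continuousD; first exact: cst_continuous.
  have cs k : ccont (fun y => g (s k (h y))) x.
    by apply: (pcont_comp (h := fun y => s k (h y))) => //; apply: ccontM => //; exact: ccont_cst.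
  have H m : (m <= n.+1)%N -> {for x, continuous (fun y => \sum_(k <- iota 0 m) aarg (u k (h y)))}.
    elim: m => [_|m IH mn].
      by apply: (continuous_ext (fun y => esym (big_nil _ _ _ _))); exact: cst_continuous.
    apply: (@continuous_ext _ _ (fun y => (\sum_(k <- iota 0 m) aarg (u k (h y))) + aarg (u m (h y)))).
      by move=> y; rewrite -[in RHS]addn1 iotaD big_cat/= big_seq1 add0n.
    apply: continuousD; first exact/IH/ltnW.
    apply: ccont_aarg; first exact: uRe.
    apply: ccontM => //; apply: ccontV => //; apply/g0/sQ => //; exact: ltnW.
  exact: H.
Qed.

End argument_lifting.

(** * The derivatives of Delta *)

Section taylor_along_rays.
Variable R : realType.
Implicit Types (t B : R) (u : nat -> R -> R).

Lemma is_derive_monomial (c t : R) j :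
  is_derive t 1 (fun x => c * x ^+ j.+1 / j.+1`!%:R) (c * t ^+ j / j`!%:R).
Proof.
have -> : (fun x : R => c * x ^+ j.+1 / j.+1`!%:R) = (c / j.+1`!%:R) *: ((@id R) ^+ j.+1).
  by apply/funext => x; rewrite [RHS]/GRing.scale /= exprfctE/= mulrAC.
apply: is_derive_eq; rewrite /GRing.scale/= mulr1 factS natrM; field.
by rewrite nat1r !pnatr_eq0 -lt0n fact_gt0.
Qed.

Lemma is_derive_continuous_within (f df : R -> R) (a b : R) :
  (forall t, is_derive t 1 f (df t)) -> {within `[a, b], continuous f}.
Proof.
move=> H; apply: derivable_within_continuous => x _.
by have [] := H x.
Qed.

(** By the mean value theorem, since [g - f] and [g + f] have nonnegative derivatives and vanish at
    [0]. *)
Lemma ler_norm_derive (f g df dg : R -> R) :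
  (forall t, is_derive t 1 f (df t)) -> (forall t, is_derive t 1 g (dg t)) ->
  f 0 = 0 -> g 0 = 0 -> (forall t, 0 <= t <= 1 -> `|df t| <= dg t) ->
  forall t, 0 <= t <= 1 -> `|f t| <= g t.
Proof.
move=> Hf Hg f0 g0 fg t /andP[t0 t1].
have key (h dh : R -> R) : (forall t, is_derive t 1 h (dh t)) -> h 0 = 0 ->
    (forall t, 0 <= t <= 1 -> dh t <= dg t) -> h t <= g t.
  move=> Hh h0 hg.
  have Hgh (x : R) : is_derive x 1 (g - h) (dg x - dh x) by exact: is_deriveB.
  have [c] := MVT_segment t0 (fun x _ => Hgh x) (is_derive_continuous_within Hgh).
  rewrite in_itv/= => /andP[c0 ct]; rewrite !fctE/= g0 h0 !subr0 => e.
  by rewrite -subr_ge0 e mulr_ge0// subr_ge0 hg// c0 (le_trans ct).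
rewrite ler_norml; apply/andP; split.
  have HfN (x : R) : is_derive x 1 (- f) (- df x) by exact: is_deriveN.
  rewrite lerNl; apply: (key _ _ HfN).
  - by rewrite -[LHS]/(- f 0) f0 oppr0.
  - by move=> x /fg; apply: le_trans; rewrite -normrN ler_norm.
by apply: (key f df Hf f0) => x /fg; apply: le_trans; exact: ler_norm.
Qed.

(** The remainder of [u m] at order [k + 1] vanishes at [0], and its derivative is the remainder of
    [u m.+1] at order [k]; the bound [B] is thus integrated [n] times. *)
Lemma real_taylor u n B : (forall m t, is_derive t 1 (u m) (u m.+1 t)) ->
  (forall t, 0 <= t <= 1 -> `|u n t| <= B) ->
  `|u 0%N 1 - \sum_(j < n) u j 0 / j`!%:R| <= B / n`!%:R.
Proof.
move=> Hu HB.
suff H k m : (m + k = n)%N -> forall t, 0 <= t <= 1 ->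
    `|u m t - \sum_(j < k) u (m + j)%N 0 * t ^+ j / j`!%:R| <= B * t ^+ k / k`!%:R.
  have := H n 0%N erefl 1; rewrite lexx ler01 expr1n mulr1 => /(_ isT).
  by under eq_bigr do rewrite expr1n mulr1.
elim: k m => [|k IH] m mkn.
  by move=> t t01; rewrite big_ord0 subr0 expr0 mulr1 divr1 -mkn addn0 in HB *; exact: HB.
apply: (@ler_norm_derive _ _ (fun t => u m.+1 t - \sum_(j < k) u (m.+1 + j)%N 0 * t ^+ j / j`!%:R)
  (fun t => B * t ^+ k / k`!%:R)).
- move=> t; have -> : (fun t => u m t - \sum_(j < k.+1) u (m + j)%N 0 * t ^+ j / j`!%:R) =
      u m - (cst (u m 0) + \sum_(j < k) (fun t => u (m.+1 + j)%N 0 * t ^+ j.+1 / j.+1`!%:R)).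
    apply/funext => x; rewrite !fctE/= fct_sumE big_ord_recl/= addn0 expr0 mulr1 divr1.
    by congr (_ - (_ + _)); apply: eq_bigr => i _; rewrite addnS addSn.
  apply: is_deriveB; rewrite -[X in is_derive _ _ _ X]add0r.
  apply: is_deriveD; apply: is_derive_sum => i; exact: is_derive_monomial.
- by move=> t; exact: is_derive_monomial.
- rewrite big_ord_recl/= addn0 expr0 mulr1 divr1 big1 ?addr0 ?subrr// => i _.
  by rewrite expr0n/= mulr0 mul0r.
- by rewrite expr0n/= mulr0 mul0r.
- by apply: IH; rewrite addSnnS.
Qed.

(** Reduction to [real_taylor] on the segment from [z] to [z + w]: the functions
    [Re (c w^k D_(m+k)(z + t w))] of [t] are successive derivatives of each other. The values
    [c = 1] and [c = -i] give the real and the imaginary part, whence the factor [2]. *)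
Lemma complex_taylor (D : nat -> R[i] -> R[i]) (m n : nat) (z w : R[i]) B :
  (forall k z r, exists C, forall w, normc w <= r ->
     normc (D k (z + w) - D k z - D k.+1 z * w) <= C * normc w ^+ 2) ->
  (forall t, 0 <= t <= 1 -> normc (D (m + n)%N (z + t%:C * w)) <= B) ->
  normc (D m (z + w) - \sum_(j < n) D (m + j)%N z * w ^+ j / j`!%:R) <=
    2 * (B * normc w ^+ n / n`!%:R).
Proof.
move=> quad HB.
have key (c : R[i]) : normc c = 1 ->
    `|Re (c * (D m (z + w) - \sum_(j < n) D (m + j)%N z * w ^+ j / j`!%:R))| <=
    B * normc w ^+ n / n`!%:R.
  move=> c1; pose u k t := Re (c * (w ^+ k * D (m + k)%N (z + t%:C * w))).
  have Hu k (t : R) : is_derive t 1 (u k) (u k.+1 t).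
    have [C HC] := quad (m + k)%N (z + t%:C * w) (normc w).
    apply: (@is_derive_of_quadratic_error _ _ _ _ (normc w ^+ k * (C * normc w ^+ 2))) => h h1.
    have := HC (h%:C * w); rewrite normcM normc_real => /(_ _)/wrap[].
      by rewrite ler_piMl ?normc_ge0.
    set E := (X in normc X) => HE.
    have -> : u k (t + h) - u k t - u k.+1 t * h = Re (c * w ^+ k * E).
      rewrite /u addnS exprSr.
      have hE x : Re x * h = Re (x * h%:C) by rewrite !ReImE mulr0 subr0.
      rewrite hE -Re_opp -Re_add -Re_opp -Re_add /E rmorphD/= mulrDl addrA; congr Re; ring.
    apply: (le_trans (ler_normr_Re _)); rewrite !normcM c1 mul1r normcX -!mulrA.
    rewrite ler_wpM2l ?exprn_ge0 ?normc_ge0//; apply: (le_trans HE).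
    by rewrite le_eqVlt; apply/orP; left; apply/eqP; ring.
  have uB t : 0 <= t <= 1 -> `|u n t| <= B * normc w ^+ n.
    move=> /HB h; apply: (le_trans (ler_normr_Re _)).
    by rewrite !normcM c1 mul1r normcX mulrC ler_wpM2r// exprn_ge0// normc_ge0.
  have := real_taylor Hu uB; congr (`|_| <= _).
  rewrite /u expr0 mul1r addn0 [1%:C]/(1 : R[i]) mul1r mulrBr Re_add Re_opp; congr (_ - _).
  rewrite mulr_sumr (big_morph (@complex.Re R) (@Re_add R) (erefl : Re (0 : R[i]) = 0)).
  apply: eq_bigr => j _; rewrite [0%:C]/(0 : R[i]) mul0r addr0.
  have -> : (j`!%:R : R[i])^-1 = (j`!%:R^-1 : R)%:C by rewrite fmorphV/= rmorph_nat.
  have hE x (h : R) : Re x * h = Re (x * h%:C) by rewrite !ReImE mulr0 subr0.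
  rewrite hE; congr Re; ring.
apply: (le_trans (normc_le _)); rewrite mulr2n mulrDl mul1r; apply: lerD.
  by have := key 1 (@normc1 R); rewrite mul1r.
have := key (0 -i* 1); rewrite !ReImE/= mul0r sub0r mulNr mul1r opprK; apply.
by rewrite expr0n add0r sqrrN expr1n sqrtr1.
Qed.

End taylor_along_rays.

(** * The complex exponential and its second-order remainder *)

Section complex_exponential.
Variable R : realType.
Implicit Types (z w : R[i]) (t : R).

Lemma cexpE z : cexp z = (expR (Re z))%:C * cis (Im z).
Proof. by []. Qed.

Lemma cexp0 : cexp 0 = 1 :> R[i].
Proof. by rewrite cexpE expR0 cis0 mulr1. Qed.

Lemma cexpD z w : cexp (z + w) = cexp z * cexp w.
Proof. by rewrite !cexpE !ReImE expRD cisD rmorphM/= mulrACA. Qed.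

Lemma normc_cexp z : normc (cexp z) = expR (Re z).
Proof. by rewrite cexpE normcM normc_cis mulr1 normc_real ger0_norm// expR_ge0. Qed.

Lemma normc_cexp_le z : normc (cexp z) <= expR (normc z).
Proof. by rewrite normc_cexp ler_expR (le_trans (ler_norm _))// ler_normr_Re. Qed.

Lemma ccont_cexp (T : topologicalType) (f : T -> R[i]) x :
  ccont f x -> ccont (fun y => cexp (f y)) x.
Proof.
move=> [fr fi].
have ce := continuous_comp fr (@continuous_expR R (Re (f x))).
have cc := continuous_comp fi (@continuous_cos R (Im (f x))).
have cs := continuous_comp fi (@continuous_sin R (Im (f x))).
split.
- apply: (@continuous_ext _ _ (fun y => expR (Re (f y)) * cos (Im (f y)))).
    by move=> y; rewrite cexpE !ReImE mul0r subr0.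
  exact: continuousM.
- apply: (@continuous_ext _ _ (fun y => expR (Re (f y)) * sin (Im (f y)))).
    by move=> y; rewrite cexpE !ReImE mul0r addr0.
  exact: continuousM.
Qed.

(** The function is the real part of [(p + iq) e^(x(a + ib))]; its derivative multiplies the
    coefficient by [a + ib]. *)
Lemma is_derive_exp_trig (a b p q t : R) :
  is_derive t 1 (fun x => expR (x * a) * (p * cos (x * b) - q * sin (x * b)))
    (expR (t * a) * ((a * p - b * q) * cos (t * b) - (a * q + b * p) * sin (t * b))).
Proof.
have lin c (x : R) : is_derive x 1 (fun y => y * c) c.
  have -> : (fun y : R => y * c) = c *: (@id R) by apply/funext => y; rewrite [RHS]mulrC.
  by apply: is_derive_eq; rewrite /GRing.scale/= mulr1.
have de : is_derive t 1 (fun x => expR (x * a)) (expR (t * a) * a).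
  exact: (@is_derive1_comp _ expR (fun x => x * a)).
have dc : is_derive t 1 (fun x => cos (x * b)) (- sin (t * b) * b).
  exact: (@is_derive1_comp _ cos (fun x => x * b)).
have ds : is_derive t 1 (fun x => sin (x * b)) (cos (t * b) * b).
  exact: (@is_derive1_comp _ sin (fun x => x * b)).
have -> : (fun x => expR (x * a) * (p * cos (x * b) - q * sin (x * b))) =
  (fun x => expR (x * a)) * (p *: (fun x => cos (x * b)) - q *: (fun x => sin (x * b))).
  by apply/funext.
apply: is_derive_eq. rewrite /GRing.scale/= !fctE.
rewrite -[(p \*: _) t]/(p * cos (t * b)) -[(q \*: _) t]/(q * sin (t * b)).
ring.
Qed.

(** Taylor's formula of order 2 for [e^(tw)] on [[0, 1]]; the real and imaginary parts each take
    half of the bound. *)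
Lemma normc_cexp_remainder w :
  normc (cexp w - 1 - w) <= normc w ^+ 2 * expR (normc w).
Proof.
have key (c : R[i]) : normc c = 1 ->
    `|Re (c * (cexp w - 1 - w))| <= normc w ^+ 2 * expR (normc w) / 2.
  move=> c1; pose u k t := Re (c * w ^+ k * cexp (t%:C * w)).
  have Hu k (t : R) : is_derive t 1 (u k) (u k.+1 t).
    have := is_derive_exp_trig (Re w) (Im w) (Re (c * w ^+ k)) (Im (c * w ^+ k)) t.
    have uE j x : u j x = expR (x * Re w) *
        (Re (c * w ^+ j) * cos (x * Im w) - Im (c * w ^+ j) * sin (x * Im w)).
      pose a : R := x * Re w; pose b : R := x * Im w; rewrite /u -/a -/b.
      have -> : x%:C * w = a +i* b.
        by apply: complex_eq; rewrite !ReImE mul0r ?subr0 ?addr0.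
      by rewrite cexpE Re_mk Im_mk [LHS]Re_mul Re_mul Im_mul !ReImE; ring.
    have -> : u k = fun x => expR (x * Re w) *
        (Re (c * w ^+ k) * cos (x * Im w) - Im (c * w ^+ k) * sin (x * Im w)).
      by apply/funext => x; exact: uE.
    rewrite uE exprSr mulrA [Re (_ * w)]Re_mul [Im (_ * w)]Im_mul.
    by congr (is_derive _ _ _ _); ring.
  have uB t : 0 <= t <= 1 -> `|u 2 t| <= normc w ^+ 2 * expR (normc w).
    move=> /andP[t0 t1]; apply: (le_trans (ler_normr_Re _)).
    rewrite normcM [normc (c * _)]normcM c1 mul1r normcX ler_wpM2l ?exprn_ge0 ?normc_ge0//.
    apply: (le_trans (normc_cexp_le _)); rewrite ler_expR normcM normc_real ger0_norm//.
    by rewrite ler_piMl// normc_ge0.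
  have := real_taylor Hu uB; congr (`|_| <= _).
  rewrite !big_ord_recr big_ord0/= /u [1%:C]/(1 : R[i]) [0%:C]/(0 : R[i]).
  rewrite mul0r cexp0 expr0 expr1 !mulr1 mul1r add0r !divr1.
  by rewrite opprD addrA -!Re_opp -!Re_add !mulrBr mulr1.
apply: (le_trans (normc_le _)); rewrite [leRHS]splitr; apply: lerD.
  by have := key 1 (@normc1 R); rewrite mul1r.
have := key (0 -i* 1); rewrite !ReImE/= mul0r sub0r mulNr mul1r opprK; apply.
by rewrite expr0n add0r sqrrN expr1n sqrtr1.
Qed.

End complex_exponential.

(** * Integrals of complex-valued functions over [[0, tau]] *)

Section complex_integral.
Variables (R : realType) (tau : R).
Local Notation mu := (@lebesgue_measure R).
Local Notation D := (`[0, tau]%classic : set R).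
Implicit Types (f g h : R -> R[i]) (N : R -> R).

Definition cintegrable f :=
  mu.-integrable D (EFin \o (fun x => Re (f x))) /\
  mu.-integrable D (EFin \o (fun x => Im (f x))).

Lemma integrable_mul_continuous N (h : R -> R) :
  mu.-integrable D (EFin \o N) -> continuous h ->
  mu.-integrable D (EFin \o (fun x => N x * h x)).
Proof.
move=> iN ch.
have -> : EFin \o (fun x => N x * h x) = ((EFin \o N) \* (EFin \o h))%E by [].
apply: integrableMl => //.
  by apply: measurable_funTS; exact: measurable_realfun.continuous_measurable_fun.
have /compact_bounded[M [Mr Mh]] : compact (h @` D).
  apply: continuous_compact; last exact: segment_compact.
  exact: continuous_subspaceT.
by exists M; split => // x /Mh {}Mh y Dy; apply: Mh; exists y.
Qed.

Lemma cintegrable_mul_continuous N f : mu.-integrable D (EFin \o N) ->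
  (forall x, ccont f x) -> cintegrable (fun x => (N x)%:C * f x).
Proof.
move=> iN cf; split.
- have -> : (fun x => Re ((N x)%:C * f x)) = fun x => N x * Re (f x).
    by apply/funext => x; rewrite !ReImE mul0r subr0.
  by apply: integrable_mul_continuous => // x; have [] := cf x.
- have -> : (fun x => Im ((N x)%:C * f x)) = fun x => N x * Im (f x).
    by apply/funext => x; rewrite !ReImE mul0r addr0.
  by apply: integrable_mul_continuous => // x; have [] := cf x.
Qed.

(** Linearity for the one combination needed later: an increment minus its first-order term. *)
Lemma cintegral_linear f g h w : cintegrable f -> cintegrable g -> cintegrable h ->
  cintegrable (fun x => f x - g x - h x * w) /\
  cintegral D f - cintegral D g - cintegral D h * w =
  cintegral D (fun x => f x - g x - h x * w).
Proof.
move=> [fr fi] [gr gi] [hr hi].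
have iZ (k : R -> R) c : mu.-integrable D (EFin \o k) ->
    mu.-integrable D (EFin \o (fun x => k x * c)).
  move=> ik; have := @integrableZr _ _ _ mu D (measurable_itv _) c _ ik.
  by congr (integrable _ _ _).
have iB (k l : R -> R) : mu.-integrable D (EFin \o k) -> mu.-integrable D (EFin \o l) ->
    mu.-integrable D (EFin \o (fun x => k x - l x)).
  move=> ik il; have := @integrableB _ _ _ mu D (measurable_itv _) _ _ ik il.
  by congr (integrable _ _ _).
have iD (k l : R -> R) : mu.-integrable D (EFin \o k) -> mu.-integrable D (EFin \o l) ->
    mu.-integrable D (EFin \o (fun x => k x + l x)).
  move=> ik il; have := @integrableD _ _ _ mu D (measurable_itv _) _ _ ik il.
  by congr (integrable _ _ _).
have ReE : (fun x => Re (f x - g x - h x * w)) =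
    fun x => (Re (f x) - Re (g x)) - (Re (h x) * Re w - Im (h x) * Im w).
  by apply/funext => x; rewrite !ReImE.
have ImE : (fun x => Im (f x - g x - h x * w)) =
    fun x => (Im (f x) - Im (g x)) - (Re (h x) * Im w + Im (h x) * Re w).
  by apply/funext => x; rewrite !ReImE.
split; rewrite /cintegrable ?ReE ?ImE.
  by split; apply: (iB); [exact: (iB)|apply: (iB); exact: (iZ)|exact: (iB)|apply: (iD); exact: (iZ)].
apply: complex_eq; rewrite !ReImE.
- rewrite -[RHS]/(Rintegral mu D (fun x => Re (f x - g x - h x * w))).
  rewrite ReE RintegralB//; [|exact: (iB)|by apply: (iB); exact: (iZ)].
  rewrite RintegralB// RintegralB//; [|exact: (iZ)|exact: (iZ)].
  by rewrite !RintegralZr.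
- rewrite -[RHS]/(Rintegral mu D (fun x => Im (f x - g x - h x * w))).
  rewrite ImE RintegralB//; [|exact: (iB)|by apply: (iD); exact: (iZ)].
  rewrite RintegralB// RintegralD//; [|exact: (iZ)|exact: (iZ)].
  by rewrite !RintegralZr.
Qed.

Lemma normc_cintegral_le f N B : cintegrable f -> mu.-integrable D (EFin \o N) ->
  (forall x, D x -> normc (f x) <= B * `|N x|) ->
  normc (cintegral D f) <= 2 * (B * Rintegral mu D (fun x => `|N x|)).
Proof.
move=> [fr fi] iN fB.
have iNn : mu.-integrable D (EFin \o (fun x => `|N x|)) by exact: integrable_norm.
have iBN : mu.-integrable D (EFin \o (fun x => B * `|N x|)).
  by have := @integrableZl _ _ _ mu D (measurable_itv _) B _ iNn; congr (integrable _ _ _).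
have key (k : R -> R) : mu.-integrable D (EFin \o k) ->
    (forall x, D x -> `|k x| <= normc (f x)) ->
    `|Rintegral mu D k| <= B * Rintegral mu D (fun x => `|N x|).
  move=> ik kf; apply: (le_trans (le_normr_Rintegral _ ik)) => //.
  rewrite -RintegralZl//; apply: le_Rintegral => //; first exact: integrable_norm.
  by move=> x Dx; apply: (le_trans (kf x Dx)); exact: fB.
apply: (le_trans (normc_le _)); rewrite mulr2n mulrDl mul1r; apply: lerD.
  by apply: (key _ fr) => x _; exact: ler_normr_Re.
by apply: (key _ fi) => x _; exact: ler_normr_Im.
Qed.

End complex_integral.

(** * Differentiation under the integral sign and growth of the derivatives *)

Section delta_derivatives.
Variables (R : realType) (tau xi : R) (N : R -> R).
Local Notation mu := (@lebesgue_measure R).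
Local Notation I := (`[0, tau]%classic : set R).
Hypotheses (tau_gt0 : 0 < tau) (N_int : mu.-integrable I (EFin \o N)).
Implicit Types (P : R -> R) (c x : R) (s z w : R[i]).

(** Delta with general coefficients: a family stable under differentiation, the derivative having
    the coefficients [0], [- tau x] and [- nu P(nu)]. *)
Definition laplace c x P s : R[i] :=
  c%:C - x%:C * cexp (- (s * tau%:C))
  - cintegral I (fun nu => (P nu)%:C * cexp (- (s * nu%:C))).

Lemma ccont_kernel s (nu : R) : ccont (fun y : R => cexp (- (s * y%:C))) nu.
Proof.
apply: ccont_cexp; apply: ccontN; apply: ccontM; first exact: ccont_cst.
by split; [exact: cvg_id|exact: cst_continuous].
Qed.

Lemma cintegrable_kernel P s : mu.-integrable I (EFin \o P) ->
  cintegrable tau (fun nu => (P nu)%:C * cexp (- (s * nu%:C))).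
Proof. by move=> iP; apply: cintegrable_mul_continuous => // nu; exact: ccont_kernel. Qed.

Lemma normc_kernel_le s nu : I nu -> normc (cexp (- (s * nu%:C))) <= expR (tau * normc s).
Proof.
rewrite /= in_itv/= => /andP[nu0 nutau].
apply: (le_trans (normc_cexp_le _)); rewrite ler_expR normc_opp normcM normc_real.
by rewrite ger0_norm// mulrC ler_wpM2r// normc_ge0.
Qed.

Let tauI : I tau. Proof. by rewrite /= in_itv/= lexx ltW. Qed.

Lemma laplace_bound c x P s : mu.-integrable I (EFin \o P) ->
  normc (laplace c x P s) <=
  `|c| + (`|x| + 2 * Rintegral mu I (fun nu => `|P nu|)) * expR (tau * normc s).
Proof.
move=> iP; rewrite /laplace; apply: (le_trans (normc_triangle _ _)).
rewrite normc_opp mulrDl addrA; apply: lerD.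
  apply: (le_trans (normc_triangle _ _)); rewrite normc_opp normc_real lerD2l.
  by rewrite normcM normc_real ler_wpM2l// normc_kernel_le.
have := @normc_cintegral_le _ tau _ P (expR (tau * normc s)) (cintegrable_kernel s iP) iP.
move=> /(_ _)/wrap[]; last by congr (_ <= _); ring.
by move=> nu Inu; rewrite normcM normc_real mulrC ler_wpM2r// normc_kernel_le.
Qed.

Lemma integrable_mulN P : mu.-integrable I (EFin \o P) ->
  mu.-integrable I (EFin \o (fun nu => P nu * - nu)).
Proof.
move=> iP; apply: integrable_mul_continuous => // x.
exact: (@continuousN _ _ _ id x (@cvg_id _ _)).
Qed.

Lemma normc_kernel_remainder s w nu r : I nu -> normc w <= r ->
  normc (cexp (- ((s + w) * nu%:C)) - cexp (- (s * nu%:C)) -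
    (- nu)%:C * cexp (- (s * nu%:C)) * w) <=
  expR (tau * normc s) * (tau ^+ 2 * expR (tau * r)) * normc w ^+ 2.
Proof.
move=> Inu wr; have := Inu; rewrite /= in_itv/= => /andP[nu0 nutau].
have -> : cexp (- ((s + w) * nu%:C)) - cexp (- (s * nu%:C)) -
    (- nu)%:C * cexp (- (s * nu%:C)) * w =
    cexp (- (s * nu%:C)) * (cexp (- (w * nu%:C)) - 1 - (- (w * nu%:C))).
  by rewrite mulrDl opprD cexpD rmorphN/=; ring.
rewrite normcM -mulrA; apply: ler_pM; rewrite ?normc_ge0//; first exact: normc_kernel_le.
apply: (le_trans (normc_cexp_remainder _)); rewrite normc_opp normcM normc_real.
rewrite (ger0_norm nu0) exprMn [normc w ^+ 2 * _]mulrC [leRHS]mulrAC.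
apply: ler_pM; rewrite ?expR_ge0 ?mulr_ge0 ?exprn_ge0 ?normc_ge0//.
  by rewrite ler_wpM2r ?exprn_ge0 ?normc_ge0// ler_pXn2r ?nnegrE// ltW.
by rewrite ler_expR mulrC ler_pM// normc_ge0.
Qed.

(** The kernel has a quadratic error bounded uniformly for [nu] in [[0, tau]], which can be
    integrated against [P]. *)
Lemma laplace_quadratic_error c x P s r : mu.-integrable I (EFin \o P) ->
  exists C, forall w, normc w <= r ->
  normc (laplace c x P (s + w) - laplace c x P s -
    laplace 0 (x * - tau) (fun nu => P nu * - nu) s * w) <= C * normc w ^+ 2.
Proof.
move=> iP; pose B := expR (tau * normc s) * (tau ^+ 2 * expR (tau * r)).
exists ((`|x| + 2 * Rintegral mu I (fun nu => `|P nu|)) * B) => w wr.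
have [fgh_int fghE] := cintegral_linear w (cintegrable_kernel (s + w) iP)
  (cintegrable_kernel s iP) (cintegrable_kernel s (integrable_mulN iP)).
have -> : laplace c x P (s + w) - laplace c x P s -
    laplace 0 (x * - tau) (fun nu => P nu * - nu) s * w =
    - (x%:C * (cexp (- ((s + w) * tau%:C)) - cexp (- (s * tau%:C)) -
      (- tau)%:C * cexp (- (s * tau%:C)) * w)) -
    (cintegral I (fun nu => (P nu)%:C * cexp (- ((s + w) * nu%:C))) -
     cintegral I (fun nu => (P nu)%:C * cexp (- (s * nu%:C))) -
     cintegral I (fun nu => (P nu * - nu)%:C * cexp (- (s * nu%:C))) * w).
  rewrite /laplace [0%:C]/(0 : R[i]) rmorphM/=; ring.
rewrite fghE; apply: (le_trans (normc_triangle _ _)); rewrite !normc_opp.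
have -> : (`|x| + 2 * Rintegral mu I (fun nu => `|P nu|)) * B * normc w ^+ 2 =
    `|x| * (B * normc w ^+ 2) +
    2 * ((B * normc w ^+ 2) * Rintegral mu I (fun nu => `|P nu|)) by ring.
apply: lerD; first by rewrite normcM normc_real ler_wpM2l// normc_kernel_remainder.
apply: (normc_cintegral_le fgh_int iP) => nu Inu.
have -> : (P nu)%:C * cexp (- ((s + w) * nu%:C)) - (P nu)%:C * cexp (- (s * nu%:C)) -
    (P nu * - nu)%:C * cexp (- (s * nu%:C)) * w =
    (P nu)%:C * (cexp (- ((s + w) * nu%:C)) - cexp (- (s * nu%:C)) -
    (- nu)%:C * cexp (- (s * nu%:C)) * w).
  by rewrite rmorphM/=; ring.
by rewrite normcM normc_real mulrC ler_wpM2r// normc_kernel_remainder.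
Qed.

(** The [n]-th derivative of Delta in closed form; the constant [1] survives only for [n = 0]. *)
Definition dDelta n := laplace (n == 0%N)%:R (xi * (- tau) ^+ n) (fun nu => N nu * (- nu) ^+ n).

Lemma dDelta0 : dDelta 0 = Delta tau xi N.
Proof.
apply/funext => s; rewrite /dDelta; have -> : (fun nu => N nu * (- nu) ^+ 0) = N.
  by apply/funext => nu; rewrite expr0 mulr1.
by rewrite expr0 mulr1.
Qed.

Lemma integrable_dDelta n : mu.-integrable I (EFin \o (fun nu => N nu * (- nu) ^+ n)).
Proof.
elim: n => [|n IH].
  have -> : (fun nu => N nu * (- nu) ^+ 0) = N.
    by apply/funext => nu; rewrite expr0 mulr1.
  exact: N_int.
have -> : (fun nu => N nu * (- nu) ^+ n.+1) = fun nu => N nu * (- nu) ^+ n * - nu.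
  by apply/funext => nu; rewrite exprSr mulrA.
exact: integrable_mulN.
Qed.

Lemma dDelta_quadratic_error n z r : exists C, forall w, normc w <= r ->
  normc (dDelta n (z + w) - dDelta n z - dDelta n.+1 z * w) <= C * normc w ^+ 2.
Proof.
have [C HC] := laplace_quadratic_error (n == 0%N)%:R (xi * (- tau) ^+ n) z r (integrable_dDelta n).
exists C => w /HC; rewrite /dDelta [(- tau) ^+ n.+1]exprSr [xi * (_ * _)]mulrA.
have -> : (fun nu => N nu * (- nu) ^+ n.+1) = fun nu => N nu * (- nu) ^+ n * - nu.
  by apply/funext => nu; rewrite exprSr mulrA.
exact.
Qed.

Definition dDelta_const := 1 + `|xi| + 2 * Rintegral mu I (fun nu => `|N nu|).

Lemma Rintegral_normN_ge0 : 0 <= Rintegral mu I (fun nu => `|N nu|).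
Proof. by apply: Rintegral_ge0. Qed.

Lemma dDelta_const_ge0 : 0 <= dDelta_const.
Proof. by rewrite !addr_ge0// mulr_ge0// Rintegral_normN_ge0. Qed.

(** Each differentiation brings out a factor of modulus at most [tau]. Growth like [tau ^+ n] is
    beaten by the factorials, so Taylor remainders tend to 0 at any distance. *)
Lemma dDelta_bound n z :
  normc (dDelta n z) <= dDelta_const * tau ^+ n * expR (tau * normc z).
Proof.
apply: (le_trans (laplace_bound _ _ _ (integrable_dDelta n))).
have e1 : 1 <= expR (tau * normc z) by rewrite -expR0 ler_expR mulr_ge0 ?normc_ge0// ltW.
have tn : 0 <= tau ^+ n by rewrite exprn_ge0// ltW.
have -> : dDelta_const * tau ^+ n * expR (tau * normc z) = tau ^+ n * expR (tau * normc z) +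
    (`|xi| * tau ^+ n + 2 * (tau ^+ n * Rintegral mu I (fun nu => `|N nu|))) * expR (tau * normc z).
  by rewrite /dDelta_const; ring.
apply: lerD.
  case: n tn => [|n] tn /=; first by rewrite normr1 expr0 mul1r.
  by rewrite normr0 mulr_ge0// expR_ge0.
rewrite ler_wpM2r ?expR_ge0// normrM normrX normrN (gtr0_norm tau_gt0) lerD2l ler_wpM2l//.
rewrite -RintegralZl//; last exact: integrable_norm.
apply: le_Rintegral => //.
- exact/integrable_norm/integrable_dDelta.
- have := @integrableZl _ _ _ mu I (measurable_itv _) (tau ^+ n) _ (integrable_norm N_int).
  by congr (integrable _ _ _).
- move=> nu; rewrite /= in_itv/= => /andP[nu0 nutau].
  rewrite normrM normrX normrN (ger0_norm nu0) mulrC ler_wpM2r//.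
  by rewrite lerXn2r ?nnegrE// ltW.
Qed.

Lemma dDelta_taylor m n z w :
  normc (dDelta m (z + w) - \sum_(j < n) dDelta (m + j) z * w ^+ j / j`!%:R) <=
  2 * (dDelta_const * tau ^+ (m + n) * expR (tau * (normc z + normc w)) *
       normc w ^+ n / n`!%:R).
Proof.
apply: complex_taylor => [k y r|t /andP[t0 t1]]; first exact: dDelta_quadratic_error.
apply: (le_trans (dDelta_bound _ _)); rewrite ler_wpM2l//.
  by rewrite mulr_ge0 ?dDelta_const_ge0// exprn_ge0// ltW.
rewrite ler_expR ler_pM2l//; apply: (le_trans (normc_triangle _ _)).
by rewrite lerD2l normcM normc_real ger0_norm// ler_piMl// normc_ge0.
Qed.

End delta_derivatives.

(** * Taylor expansions of Delta and [M], nonvanishing and symmetry *)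

Section delta_consequences.
Variable R : realType.

Lemma ccont_of_lipschitz (g : R[i] -> R[i]) (p : R * R) :
  (exists C, forall w, normc w <= 1 ->
     normc (g (p.1 +i* p.2 + w) - g (p.1 +i* p.2)) <= C * normc w) ->
  ccont (fun q : R * R => g (q.1 +i* q.2)) p.
Proof.
move=> [C HC]; have C0 : 0 <= C.
  have := HC 1; rewrite normc1 lexx mulr1 => /(_ isT).
  by apply: le_trans; exact: normc_ge0.
have key (e : R) : 0 < e -> \forall q \near p,
    normc (g (q.1 +i* q.2) - g (p.1 +i* p.2)) <= e.
  (* Since [|w| <= 2 d], the bound [1 / 2] keeps [w] in the unit disc and the other one makes
     [C |w| <= e]. *)
  move=> e0; pose d := Num.min (1 / 2) (e / (2 * (C + 1))).
  have d0 : 0 < d by rewrite lt_min !divr_gt0//= mulr_gt0// ltr_wpDl.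
  apply/nbhs_ballP; exists d => // q [q1 q2].
  pose w := (q.1 - p.1) +i* (q.2 - p.2).
  have wd : normc w <= 2 * d.
    apply: (le_trans (normc_le _)); rewrite mulr2n mulrDl mul1r.
    by apply: lerD; rewrite distrC ltW.
  have -> : q.1 +i* q.2 = p.1 +i* p.2 + w.
    by apply: complex_eq; rewrite !ReImE addrC subrK.
  have w1 : normc w <= 1.
    by apply: (le_trans wd); rewrite -ler_pdivlMl// mulrC ge_min lexx.
  apply: (le_trans (HC w w1)); apply: (@le_trans _ _ ((C + 1) * (2 * d))).
    by apply: ler_pM; rewrite ?normc_ge0// lerDl.
  rewrite mulrCA mulrA -ler_pdivlMl ?mulr_gt0 ?ltr_wpDl// mulrC ge_min.
  by apply/orP; right.
split; apply/cvgrPdist_le => e /key; apply: filterS => q; apply: le_trans.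
- by rewrite distrC -Re_opp -Re_add; exact: ler_normr_Re.
- by rewrite distrC -Im_opp -Im_add; exact: ler_normr_Im.
Qed.

Lemma le0_of_exp_coeff (a c x : R) :
  (forall n, a <= c * (x ^+ n / n`!%:R)) -> a <= 0.
Proof.
move=> H; have cx : c * (x ^+ n / n`!%:R) @[n --> \oo] --> c * 0.
  by apply: cvgMr; exact: (cvg_series_cvg_0 (is_cvg_series_exp_coeff x)).
rewrite mulr0 in cx; rewrite leNgt; apply/negP => a0.
have [n _] := cvgr_lt _ cx _ a0; move=> /(_ n (leqnn n)).
by rewrite /= ltNge H.
Qed.

Variables (tau xi : R) (N : R -> R).
Local Notation mu := (@lebesgue_measure R).
Local Notation I := (`[0, tau]%classic : set R).
Hypotheses (tau_gt0 : 0 < tau) (N_int : mu.-integrable I (EFin \o N)).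
Local Notation dDelta := (dDelta tau xi N).
Local Notation Delta := (Delta tau xi N).

Lemma natr_complex (n : nat) : (n%:R : R[i]) = (n%:R)%:C.
Proof. by rewrite rmorph_nat. Qed.

Definition dDelta_bnd m n (z : R[i]) := 2 * (dDelta_const tau xi N * tau ^+ (m + n) *
  expR (tau * (normc z + 1)) / n`!%:R).

Lemma dDelta_taylor_unit m n z w : normc w <= 1 ->
  normc (dDelta m (z + w) - \sum_(j < n) dDelta (m + j) z * w ^+ j / j`!%:R) <=
  dDelta_bnd m n z * normc w ^+ n.
Proof.
move=> w1; apply: (le_trans (dDelta_taylor xi tau_gt0 N_int m n z w)).
rewrite /dDelta_bnd -!mulrA ler_pM2l// [X in _ <= _ * (_ * (_ * X))]mulrC mulrA [leRHS]mulrA.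
rewrite ler_wpM2l//.
  by rewrite mulr_ge0 ?dDelta_const_ge0 ?exprn_ge0// ltW.
rewrite ler_wpM2r ?mulr_ge0 ?exprn_ge0 ?invr_ge0 ?normc_ge0//.
by rewrite ler_expR ler_pM2l// lerD2l.
Qed.

Lemma local_taylor_dDelta : local_taylor (dDelta : nat -> R[i] -> R[i]).
Proof.
move=> m n z; exists (dDelta_bnd m n z)%:C => w.
rewrite -[`|w|]/((normc w)%:C) -[1]/((1 : R)%:C) lecR => w1.
rewrite -rmorphXn -rmorphM lecR; exact: dDelta_taylor_unit.
Qed.

(** By the chain rule along the imaginary axis, each derivative in [omega] brings out a factor
    [i]. *)
Definition dM n (omega : R) := Re ((0 +i* 1) ^+ n * dDelta n (0 +i* omega)).

Lemma dM0 : dM 0 = Mfun tau xi N.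
Proof. by apply/funext => x; rewrite /dM expr0 mul1r dDelta0. Qed.

Lemma Re_sum (I' : Type) (s : seq I') (F : I' -> R[i]) :
  Re (\sum_(i <- s) F i) = \sum_(i <- s) Re (F i).
Proof. exact: (big_morph (@complex.Re R) (@Re_add R) erefl). Qed.

Lemma dM_remainder m n (x h : R) :
  dM m (x + h) - \sum_(j < n) dM (m + j) x * h ^+ j / j`!%:R =
  Re ((0 +i* 1) ^+ m * (dDelta m (0 +i* x + 0 +i* h) -
    \sum_(j < n) dDelta (m + j) (0 +i* x) * (0 +i* h) ^+ j / j`!%:R)).
Proof.
rewrite mulrBr Re_add Re_opp; congr (Re (_ * dDelta _ _) - _).
  by apply: complex_eq; rewrite !ReImE ?addr0.
rewrite mulr_sumr Re_sum; apply: eq_bigr => j _; rewrite /dM.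
have hE (z : R[i]) (a : R) : Re z * a = Re (z * a%:C) by rewrite !ReImE mulr0 subr0.
have -> : 0 +i* h = (0 +i* 1) * h%:C :> R[i].
  by apply: complex_eq; rewrite !ReImE ?mul0r ?mulr0 ?mul1r ?subr0 ?add0r.
rewrite -mulrA hE natr_complex -fmorphV exprMn exprD rmorphM rmorphXn/=; congr Re; ring.
Qed.

Lemma normc_i : normc (0 +i* 1 : R[i]) = 1.
Proof. by rewrite /= expr0n add0r expr1n sqrtr1. Qed.

Lemma normc_imag (h : R) : normc (0 +i* h) = `|h|.
Proof. by rewrite /= expr0n add0r sqrtr_sqr. Qed.

Lemma local_taylor_dM : local_taylor dM.
Proof.
move=> m n x; exists (dDelta_bnd m n (0 +i* x)) => h h1; rewrite dM_remainder.
apply: (le_trans (ler_normr_Re _)); rewrite normcM normcX normc_i expr1n mul1r.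
by rewrite -[`|h|]normc_imag; apply: dDelta_taylor_unit; rewrite normc_imag.
Qed.

(** The remainders are at most a multiple of [(tau |w|)^n / n!], which tends to 0. This serves as an
    identity theorem: it carries the vanishing of all derivatives from one point to another. *)
Lemma dDelta_remainder_vanishing z (w : R[i]) (a : R) :
  (forall n, a <= normc (dDelta 0 (z + w) - \sum_(j < n) dDelta j z * w ^+ j / j`!%:R)) ->
  a <= 0.
Proof.
move=> H; apply: (@le0_of_exp_coeff _ (2 * (dDelta_const tau xi N *
  expR (tau * (normc z + normc w)))) (tau * normc w)) => n.
apply: (le_trans (H n)); apply: (le_trans (dDelta_taylor xi tau_gt0 N_int 0 n z w)).
rewrite add0n exprMn le_eqVlt; apply/orP; left; apply/eqP; ring.
Qed.

Hypothesis N_lt : Rintegral mu I N < 1 - xi.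

(** At [0] all exponentials are [1], so the value is [1 - xi - int N]. *)
Lemma Mfun0_gt0 : 0 < Mfun tau xi N 0.
Proof.
have z0 (nu : R) : - ((0 +i* 0) * nu%:C) = 0 :> R[i] by apply: complex_eq; rewrite !ReImE; ring.
rewrite /Mfun /Defs.Delta !Re_add !Re_opp z0 cexp0 mulr1 Re_real.
rewrite -[Re (cintegral _ _)]/(Rintegral mu I (fun nu => Re ((N nu)%:C * cexp (- ((0 +i* 0) * nu%:C))))).
under eq_Rintegral do rewrite z0 cexp0 mulr1 Re_real.
by rewrite Re_real subr_gt0.
Qed.

(* Otherwise the Taylor expansion at [z] makes Delta vanish at 0. *)
Lemma dDelta_neq0 z : exists n, dDelta n z != 0.
Proof.
apply: contrapT => /forallNP H; have {}H n : dDelta n z = 0 by apply/eqP/negPn/negP/H.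
have : Mfun tau xi N 0 <= 0; last by rewrite leNgt Mfun0_gt0.
apply: (@dDelta_remainder_vanishing z (0 +i* 0 - z)) => n.
rewrite big1 ?subr0 => [|j _]; last by rewrite H !mul0r.
rewrite addrC subrK dDelta0; apply: (le_trans (ler_norm _)); exact: ler_normr_Re.
Qed.

(** If all derivatives vanished at [x], [M(0)] would be the Taylor remainder of [M] for the step
    [- x], which is the real part of a remainder of Delta; these tend to 0, but [M(0)] is
    positive. *)
Lemma dM_neq0 x : exists n, dM n x != 0.
Proof.
apply: contrapT => /forallNP H; have {}H n : dM n x = 0 by apply/eqP/negPn/negP/H.
have : Mfun tau xi N 0 <= 0; last by rewrite leNgt Mfun0_gt0.
apply: (@dDelta_remainder_vanishing (0 +i* x) (0 +i* - x)) => n.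
have := dM_remainder 0 n x (- x); rewrite subrr big1 => [|j _]; last by rewrite H !mul0r.
rewrite expr0 mul1r subr0 dM0 => ->; apply: (le_trans (ler_norm _)); exact: ler_normr_Re.
Qed.

Lemma pcont_Delta : pcont Delta.
Proof.
move=> p; set z := p.1 +i* p.2; apply: ccont_of_lipschitz.
exists (dDelta_bnd 0 1 z) => w /(dDelta_taylor_unit 0 1 z).
by rewrite big_ord1 expr0 mulr1 divr1 expr1 dDelta0.
Qed.

(** Within the chosen radius the Taylor remainder is smaller than the leading term [a (x - t)^p], so
    [M] has the sign of that term. *)
Lemma sgr_like_power_Mfun t p : zero_mult (Mfun tau xi N) t p ->
  sgr_like_power (Mfun tau xi N) t p.
Proof.
rewrite -dM0 => zM; have [Dp [C [C0 HC]]] := zero_mult_leading local_taylor_dM zM.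
pose a := dM p t / p`!%:R.
have a0 : a != 0 by rewrite mulf_neq0// invr_eq0 pnatr_eq0 -lt0n fact_gt0.
exists (Num.min 1 (`|a| / (C + 1))).
  by rewrite lt_min ltr01 divr_gt0 ?normr_gt0// ltr_wpDl.
exists (Num.sg a) => x /andP[xt0]; rewrite lt_min => /andP[xt1 xta].
have := HC (x - t) (ltW xt1); rewrite [t + _]addrC subrK -/a exprS mulrA => Hx.
have {Hx} : `|dM 0 x - a * (x - t) ^+ p| < `|a * (x - t) ^+ p|.
  apply: (le_lt_trans Hx); rewrite normrM normrX ltr_pM2r ?exprn_gt0//.
  by move: xta; rewrite ltr_pdivlMr ?ltr_wpDl// mulrC; apply: le_lt_trans; rewrite ler_wpM2r// lerDl.
rewrite -sgrX -sgrM; set y := a * _; set v := dM 0 x => vy.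
have [y0|y0|y0] := sgrP y.
- by move: vy; rewrite y0 normr0 ltNge normr_ge0.
- by apply: gtr0_sg; move: vy; rewrite (gtr0_norm y0) ltr_norml; lra.
- by apply: ltr0_sg; move: vy; rewrite (ltr0_norm y0) ltr_norml; lra.
Qed.

(** [xi] and [N] are real, so conjugating [s] conjugates the kernel and hence the integral. *)
Lemma Delta_conj z :
  Re (Delta (z^*)%C) = Re (Delta z) /\ Im (Delta (z^*)%C) = - Im (Delta z).
Proof.
have Re_conj (w : R[i]) : Re (w^*)%C = Re w by case: w.
have Im_conj (w : R[i]) : Im (w^*)%C = - Im w by case: w.
pose k (w : R[i]) (nu : R) := cexp (- (w * nu%:C)).
have kconj nu : Re (k (z^*)%C nu) = Re (k z nu) /\ Im (k (z^*)%C nu) = - Im (k z nu).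
  rewrite /k; have -> : - ((z^*)%C * nu%:C) = ((- (z * nu%:C))^*)%C.
    by apply: complex_eq; rewrite ?Re_conj ?Im_conj !ReImE ?Re_conj ?Im_conj; ring.
  by rewrite !cexpE Re_conj Im_conj !ReImE cosN sinN; split; ring.
have ki : mu.-integrable I (EFin \o (fun x => Im ((N x)%:C * k z x))).
  exact: (cintegrable_kernel z N_int).2.
pose F (l : R -> R[i]) := 1 - xi%:C * l tau - cintegral I (fun nu => (N nu)%:C * l nu).
rewrite -[Delta (z^*)%C]/(F (k (z^*)%C)) -[Delta z]/(F (k z)) /F.
move: (k z) (k (z^*)%C) kconj ki => k1 k2 kconj ki; have [kt1 kt2] := kconj tau; split.
- rewrite !Re_add !Re_opp !Re_mul !Re_real !Im_real kt1 kt2 !mul0r.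
  congr (_ - _); apply: eq_Rintegral => nu _.
  by rewrite !Re_mul !Im_real; have [-> ->] := kconj nu; ring.
- rewrite !Im_add !Im_opp !Im_mul !Re_real !Im_real kt1 kt2 !mul0r.
  have -> : Im (cintegral I (fun nu => (N nu)%:C * k2 nu)) =
      - Im (cintegral I (fun nu => (N nu)%:C * k1 nu)).
    rewrite -[LHS]/(Rintegral mu I (fun nu => Im ((N nu)%:C * k2 nu))) -[RHS]mulN1r.
    rewrite -[Im (cintegral _ _)]/(Rintegral mu I (fun nu => Im ((N nu)%:C * k1 nu))).
    rewrite -(@RintegralZl _ _ _ mu I (fun nu => Im ((N nu)%:C * k1 nu)) (-1))//.
    apply: eq_Rintegral => nu _.
    by rewrite !Im_mul !Im_real; have [-> ->] := kconj nu; ring.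
  by rewrite !addr0 !sub0r mulrN opprD !opprK.
Qed.

Lemma Mfun_even x : Mfun tau xi N (- x) = Mfun tau xi N x.
Proof.
by rewrite /Mfun -(Delta_conj _).1; congr (Re (Delta _)); apply: complex_eq => /=; rewrite ?opprK.
Qed.

Lemma Sfun_odd x : Sfun tau xi N (- x) = - Sfun tau xi N x.
Proof.
by rewrite /Sfun -(Delta_conj _).2; congr (Im (Delta _)); apply: complex_eq => /=; rewrite ?opprK.
Qed.

End delta_consequences.

(** * The Riemann-Lebesgue lemma in the right half-plane *)

Section riemann_lebesgue.
Variables (R : realType) (tau : R).
Local Notation mu := (@lebesgue_measure R).
Hypothesis tau_gt0 : 0 < tau.
Implicit Types (x y a b nu e : R) (phi : R -> R).

(** The real part of [e^(-(x + iy) nu)]. *)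
Definition damped_cos x y nu := expR (nu * - x) * cos (nu * y).

Lemma continuous_mul (f g : R -> R) : continuous f -> continuous g ->
  continuous (fun t => f t * g t).
Proof. by move=> cf cg t; exact: (continuousM (cf t) (cg t)). Qed.

Lemma continuous_damped_cos x y : continuous (damped_cos x y).
Proof.
have lin c : continuous (fun t : R => t * c).
  by apply: continuous_mul; [exact: (fun t => @cvg_id _ _)|exact: cst_continuous].
apply: continuous_mul => t.
  exact: (continuous_comp (lin (- x) t) (@continuous_expR R _)).
exact: (continuous_comp (lin y t) (@continuous_cos R _)).
Qed.

Lemma normr_damped_cos_le1 x y nu : 0 <= x -> 0 <= nu -> `|damped_cos x y nu| <= 1.
Proof.
move=> x0 nu0; rewrite normrM ger0_norm ?expR_ge0//.
have e1 : expR (nu * - x) <= 1 by rewrite -expR0 ler_expR mulrN oppr_le0 mulr_ge0.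
have c1 : `|cos (nu * y)| <= 1 by rewrite ler_norml cos_geN1 cos_le1.
by rewrite -[1]mulr1; apply: ler_pM => //; rewrite expR_ge0.
Qed.

Lemma integrable_continuous phi a b : continuous phi ->
  mu.-integrable `[a, b] (EFin \o phi).
Proof.
move=> cphi; apply: continuous_compact_integrable; first exact: segment_compact.
exact: continuous_subspaceT.
Qed.

Lemma normr_Rintegral_damped_cos x y a b : 0 <= x -> 0 <= a -> a < b -> 0 < normc (x +i* y) ->
  `|Rintegral mu `[a, b] (damped_cos x y)| <= 4 / normc (x +i* y).
Proof.
move=> x0 a0 ab; set n := normc _ => n0.
have n2 : n ^+ 2 = x ^+ 2 + y ^+ 2 by rewrite normc_sqr.
have n2neq0 : n ^+ 2 != 0 by rewrite expf_neq0// gt_eqF.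
(* [p + iq] is the inverse of [- x + iy], so [F] is the real part of a primitive of
   [e^(t(- x + iy))]. *)
pose p := - x / n ^+ 2; pose q := - y / n ^+ 2.
pose F t := expR (t * - x) * (p * cos (t * y) - q * sin (t * y)).
have dF (t : R) : is_derive t 1 F (damped_cos x y t).
  have := is_derive_exp_trig (- x) y p q t; rewrite -/F.
  have -> : - x * p - y * q = 1 by rewrite /p /q -[RHS](divff n2neq0) n2; ring.
  have -> : - x * q + y * p = 0 by rewrite /p /q; ring.
  by rewrite mul1r mul0r subr0.
have cF : continuous F.
  by move=> t; apply/differentiable_continuous/derivable1_diffP; have [] := dF t.
have -> : Rintegral mu `[a, b] (damped_cos x y) = F b - F a.
  rewrite /Rintegral (@continuous_FTC2 _ _ F)//.
  - by apply: continuous_subspaceT; exact: continuous_damped_cos.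
  - split.
    + by move=> t _; have [] := dF t.
    + exact/cvg_at_right_filter/cF.
    + exact/cvg_at_left_filter/cF.
  - by move=> t _; rewrite derive1E; have dt := dF t; rewrite derive_val.
have FE t : 0 <= t -> `|F t| <= 2 / n.
  move=> t0; rewrite normrM ger0_norm ?expR_ge0//.
  have e1 : expR (t * - x) <= 1 by rewrite -expR0 ler_expR mulrN oppr_le0 mulr_ge0.
  have nm (u v w : R) : `|w| <= 1 -> `|u| <= n -> `|- u / n ^+ 2 * w| <= n^-1.
    move=> w1 un; rewrite -[n^-1]mulr1 normrM; apply: ler_pM => //.
    rewrite normrM normrN normfV (ger0_norm (exprn_ge0 _ (ltW n0))).
    by rewrite ler_pdivrMr ?exprn_gt0// expr2 mulrA mulVf ?mul1r// gt_eqF.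
  rewrite -[2 / n]mul1r; apply: ler_pM; rewrite ?expR_ge0//.
  apply: (le_trans (ler_normB _ _)); rewrite mulr2n mulrDl mul1r; apply: lerD; apply: nm => //.
  - by rewrite ler_norml cos_geN1 cos_le1.
  - exact: (ler_normr_Re (x +i* y)).
  - by rewrite ler_norml sin_geN1 sin_le1.
  - exact: (ler_normr_Im (x +i* y)).
apply: (le_trans (ler_normB _ _)).
have -> : 4 / n = 2 / n + 2 / n by ring.
by apply: lerD; apply: FE => //; exact: le_trans (ltW ab).
Qed.

Lemma uniformly_continuous_segment phi e : continuous phi -> 0 < e ->
  exists n : nat, forall a b, 0 <= a <= tau -> `|b - a| <= tau / n.+1%:R ->
    `|phi b - phi a| <= e.
Proof.
move=> cphi e0; have := @segment_compact R 0 tau.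
move=> /compact_near_coveringP/(_ nat \oo (fun n a => forall b, `|b - a| <= tau / n.+1%:R ->
  `|phi b - phi a| <= e)) cK.
have [] := cK _; last first.
  move=> n _ /(_ n (leqnn n)) Hn; exists n => a b a01; apply: Hn.
  by rewrite /= in_itv.
move=> a _.
have : \forall b \near a, `|phi a - phi b| <= e / 2.
  by move/cvgrPdist_le : (cphi a); apply; rewrite divr_gt0.
move=> /nbhs_ballP[d /= d0 Hd].
exists (ball a (d / 2), [set n | tau / n.+1%:R < d / 2]).
  split; first by apply: nbhsx_ballx; rewrite divr_gt0.
  have := near_infty_natSinv_lt (PosNum (divr_gt0 (divr_gt0 d0 (@ltr0Sn R 1)) tau_gt0)).
  by apply: filterS => n /=; rewrite ltr_pdivlMr// mulrC; exact.
move=> [a' n] /= [aa' nd] b ba'.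
have H1 : `|phi a - phi a'| <= e / 2 by apply: Hd; apply: le_ball aa'; lra.
have H2 : `|phi a - phi b| <= e / 2.
  apply: Hd; rewrite /ball/= -(subrK a' a) -addrA; apply: (le_lt_trans (ler_normD _ _)).
  by rewrite [d]splitr ltrD// distrC (le_lt_trans ba').
have -> : phi b - phi a' = (phi a - phi a') - (phi a - phi b) by ring.
by apply: (le_trans (ler_normB _ _)); lra.
Qed.

(** [[0, tau]] is cut into [n + 1] intervals on which [phi] varies by at most [e / (2 tau)].
    Replacing [phi] by its value at the left end costs at most [e / 2] in all, and each constant
    piece is [O(1 / |s|)]. Nothing depends on [x >= 0], so the threshold is uniform in the closed
    half-plane. *)
Lemma riemann_lebesgue_continuous phi e : continuous phi -> 0 < e ->
  exists2 W, 0 < W & forall x y, 0 <= x -> W <= normc (x +i* y) ->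
    `|Rintegral mu `[0, tau] (fun nu => phi nu * damped_cos x y nu)| <= e.
Proof.
move=> cphi e0.
have [|n Hn] := @uniformly_continuous_segment phi (e / (2 * tau)) cphi.
  by rewrite divr_gt0// mulr_gt0.
have [B B0 HB] : exists2 B, 0 < B & forall a, 0 <= a <= tau -> `|phi a| <= B.
  have /compact_bounded[M [Mr Mh]] : compact (phi @` `[0, tau]).
    by apply: continuous_compact; [exact: continuous_subspaceT|exact: segment_compact].
  exists (`|M| + 1); first by rewrite ltr_wpDl.
  move=> a a0t; apply: (Mh (`|M| + 1)); last by exists a; rewrite //= in_itv.
  by rewrite (le_lt_trans (ler_norm _))// ltrDl.
pose h := tau / n.+1%:R; have h0 : 0 < h by rewrite divr_gt0.
(* The [n + 1] constant pieces contribute at most [4 (n + 1) B / s], which this threshold makes at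
   most [e / 2]. *)
exists (8 * n.+1%:R * B / e); first by rewrite divr_gt0// !mulr_gt0.
move=> x y x0; set s := normc _ => Ws.
have s0 : 0 < s by apply: lt_le_trans Ws; rewrite divr_gt0// !mulr_gt0.
pose f nu := phi nu * damped_cos x y nu.
have cf : continuous f by apply: continuous_mul => //; exact: continuous_damped_cos.
have claim k : (k <= n.+1)%N ->
    `|Rintegral mu `[0, k%:R * h] f| <= k%:R * (h * (e / (2 * tau)) + B * (4 / s)).
  elim: k => [_|k IH kn]; first by rewrite !mul0r set_itv1 Rintegral_set1 normr0.
  set a := k%:R * h; set b := k.+1%:R * h.
  have ab : b = a + h by rewrite /b -natr1 mulrDl mul1r.
  have a0 : 0 <= a by rewrite mulr_ge0// ltW.
  have btau : b <= tau.
    have k1 : k.+1%:R / n.+1%:R <= 1 :> R by rewrite ler_pdivrMr// mul1r ler_nat.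
    by rewrite /b /h mulrCA ler_piMr ?(ltW tau_gt0).
  have abl : a < b by rewrite ab ltrDl.
  have -> : Rintegral mu `[0, b] f = Rintegral mu `[0, a] f + Rintegral mu `[a, b] f.
    rewrite -(Rintegral_itv_obnd_cbnd (r := a)).
      rewrite -(@Rintegral_itvB _ f (BLeft 0) (BRight b) a) ?bnd_simp//.
      - by rewrite addrC subrK.
      - exact: integrable_continuous.
      - exact: ltW.
    by apply: integrableS (integrable_continuous a b cf) => //; apply: subset_itvr; rewrite bnd_simp.
  have -> : Rintegral mu `[a, b] f =
      Rintegral mu `[a, b] (fun nu => (phi nu - phi a) * damped_cos x y nu) +
      phi a * Rintegral mu `[a, b] (damped_cos x y).
    rewrite -RintegralZl//; last exact/integrable_continuous/continuous_damped_cos.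
    rewrite -RintegralD//.
    - by apply: eq_Rintegral => nu _; rewrite -mulrDl subrK.
    - apply: integrable_continuous; apply: continuous_mul; last exact: continuous_damped_cos.
      by move=> nu; exact: (continuousB (cphi nu) (@cst_continuous _ _ (phi a) nu)).
    - apply: integrable_continuous; apply: continuous_mul; last exact: continuous_damped_cos.
      exact: cst_continuous.
  have H1 : `|Rintegral mu `[a, b] (fun nu => (phi nu - phi a) * damped_cos x y nu)| <=
      h * (e / (2 * tau)).
    have ig : mu.-integrable `[a, b] (EFin \o (fun nu => (phi nu - phi a) * damped_cos x y nu)).
      apply: integrable_continuous; apply: continuous_mul; last exact: continuous_damped_cos.
      by move=> nu; exact: (continuousB (cphi nu) (@cst_continuous _ _ (phi a) nu)).
    apply: (le_trans (le_normr_Rintegral _ ig)) => //.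
    have -> : h * (e / (2 * tau)) = Rintegral mu `[a, b] (fun=> e / (2 * tau)).
      have muab : mu `[a, b] = h%:E.
        by rewrite lebesgue_measure_itv/= lte_fin abl -EFinB ab [a + h]addrC addrK.
      rewrite (@Rintegral_cst _ _ _ mu `[a, b])//.
      by rewrite [X in fine X]muab mulrC.
    apply: le_Rintegral => //; first exact: integrable_norm.
      by apply: integrable_continuous; exact: cst_continuous.
    move=> nu; rewrite /= in_itv/= => /andP[anu nub]; rewrite normrM.
    have nu0 : 0 <= nu by exact: le_trans anu.
    rewrite -[leRHS]mulr1; apply: ler_pM => //; last exact: normr_damped_cos_le1.
    apply: Hn; first by rewrite a0 (le_trans (ltW abl)).
    by rewrite ger0_norm ?subr_ge0// lerBlDl -/h -ab.
  have H2 : `|phi a * Rintegral mu `[a, b] (damped_cos x y)| <= B * (4 / s).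
    rewrite normrM; apply: ler_pM => //; first by apply: HB; rewrite a0 (le_trans (ltW abl)).
    exact: normr_Rintegral_damped_cos.
  apply: (le_trans (ler_normD _ _)); rewrite -natr1 mulrDl mul1r; apply: lerD.
    exact/IH/ltnW.
  by apply: (le_trans (ler_normD _ _)); exact: lerD.
have := claim n.+1 (leqnn _); rewrite /h mulrCA divff ?pnatr_eq0// mulr1 => /le_trans; apply.
have -> : n.+1%:R * (tau / n.+1%:R * (e / (2 * tau)) + B * (4 / s)) =
    e / 2 + 8 * n.+1%:R * B / s / 2.
  by field; rewrite !gt_eqF//= ?ltr0n// -?natr1 ?ltr_wpDl.
have : 8 * n.+1%:R * B / s <= e.
  by rewrite ler_pdivrMr// -ler_pdivrMl// [e^-1 * _]mulrC.
lra.
Qed.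

(** Continuous functions are dense in L1, and the kernel is bounded by [1] on the half-plane, so the
    approximation error is independent of [x] and [y]. *)
Lemma riemann_lebesgue (N : R -> R) e : mu.-integrable `[0, tau] (EFin \o N) -> 0 < e ->
  exists2 W, 0 < W & forall x y, 0 <= x -> W <= normc (x +i* y) ->
    `|Rintegral mu `[0, tau] (fun nu => N nu * damped_cos x y nu)| <= e.
Proof.
move=> iN e0; have e2 : 0 < e / 2 by rewrite divr_gt0.
have mutau : mu `[0, tau] = tau%:E.
  by rewrite lebesgue_measure_itv/= lte_fin tau_gt0 -EFinB subr0.
have [] := @approximation_continuous_integrable R `[0, tau] N _ _ iN.
- exact: measurable_itv.
- by rewrite [X in (X < _)%E]mutau ltry.
move=> g [cg ig Ng].
have [m Hm] : exists m, Rintegral mu `[0, tau] (fun nu => `|N nu - g m nu|) < e / 2.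
  have e2' : (0 < (e / 2)%:E)%E by rewrite lte_fin.
  have := Ng _ (open_ereal_lt' e2').
  move=> [m _ /(_ m (leqnn m))] /= H; exists m; rewrite -lte_fin /Rintegral fineK//.
  rewrite ge0_fin_numE ?integral_ge0//; exact: (lt_trans H (ltry _)).
have [W W0 HW] := riemann_lebesgue_continuous (cg m) e2.
exists W => // x y x0 /(HW x y x0) Hg.
have cd := @continuous_damped_cos x y.
have iNg : mu.-integrable `[0, tau] (EFin \o (fun nu => N nu - g m nu)).
  by have := @integrableB _ _ _ mu _ (measurable_itv _) _ _ iN (ig m); congr (integrable _ _ _).
have -> : Rintegral mu `[0, tau] (fun nu => N nu * damped_cos x y nu) =
    Rintegral mu `[0, tau] (fun nu => (N nu - g m nu) * damped_cos x y nu) +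
    Rintegral mu `[0, tau] (fun nu => g m nu * damped_cos x y nu).
  rewrite -RintegralD//; [|exact: integrable_mul_continuous|exact: integrable_mul_continuous].
  by apply: eq_Rintegral => nu _; rewrite -mulrDl subrK.
apply: (le_trans (ler_normD _ _)); rewrite [e]splitr; apply: lerD => //.
have iNgd := integrable_mul_continuous iNg cd.
apply: (le_trans (le_normr_Rintegral _ iNgd)) => //; apply: le_trans (ltW Hm).
apply: le_Rintegral => //; [exact: integrable_norm|exact: integrable_norm|].
move=> nu; rewrite /= in_itv/= => /andP[nu0 _].
by rewrite normrM ler_piMr// normr_damped_cos_le1.
Qed.

Lemma Re_Delta_gt0 (xi : R) (N : R -> R) : mu.-integrable `[0, tau] (EFin \o N) ->
  `|xi| < 1 -> exists2 W, 0 < W & forall s, 0 <= Re s -> W <= normc s ->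
    0 < Re (Delta tau xi N s).
Proof.
(* The term in [xi] costs at most [|xi|] and the integral half of the remaining margin
   [1 - |xi|]. *)
move=> iN xi1; have e0 : 0 < (1 - `|xi|) / 2 by rewrite divr_gt0// subr_gt0.
have [W W0 HW] := riemann_lebesgue iN e0; exists W => // s.
have -> : s = Re s +i* Im s by case: s.
move: (Re s) (Im s) => x y; rewrite Re_mk => x0 Ws.
have kE nu : Re (cexp (- ((x +i* y) * nu%:C))) = damped_cos x y nu.
  rewrite cexpE !ReImE /damped_cos -[RHS]subr0; congr (expR _ * _ - _); first by ring.
    by rewrite -cosN; congr cos; ring.
  by ring.
have := HW x y x0 Ws; have := normr_damped_cos_le1 y x0 (ltW tau_gt0).
rewrite /Delta !Re_add !Re_opp Re_mul Re_real Im_real kE.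
have -> : Re (cintegral `[0, tau] (fun nu => (N nu)%:C * cexp (- ((x +i* y) * nu%:C)))) =
    Rintegral mu `[0, tau] (fun nu => N nu * damped_cos x y nu).
  by apply: eq_Rintegral => nu _; rewrite Re_mul Re_real Im_real kE mul0r subr0.
move: (damped_cos x y tau) (Rintegral _ _ _) => d J d1 J1.
rewrite ?Re_real mul0r subr0.
have : `|xi * d| <= `|xi| by rewrite normrM ler_piMr.
move: J1; rewrite !ler_norml; lra.
Qed.

End riemann_lebesgue.

(** * The argument principle on a half-disc *)

Section quotient_by_zeros.
Variables (R : realType) (tau xi : R) (N : R -> R).
Local Notation mu := (@lebesgue_measure R).
Hypotheses (tau_gt0 : 0 < tau) (N_int : mu.-integrable `[0, tau] (EFin \o N)).
Local Notation dDelta := (dDelta tau xi N).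
Local Notation Delta := (Delta tau xi N).
Variable zs : seq R[i].
Hypothesis zs_mult : forall z, z \in zs -> zero_mult Delta z (count_mem z zs).
Implicit Types (z w : R[i]).

Definition other_factors z w := \prod_(y <- zs | y != z) (w - y).

Lemma prod_factors z w :
  \prod_(y <- zs) (w - y) = (w - z) ^+ count_mem z zs * other_factors z w.
Proof.
rewrite (bigID (pred1 z))/=; congr (_ * _).
rewrite -big_filter (_ : seq.filter _ _ = nseq (count_mem z zs) z).
  by elim: (count_mem z zs) => [|n IH]; rewrite ?big_nil ?expr0//= big_cons IH exprS.
by elim: zs => //= y t ->; case: eqVneq => [->|].
Qed.

Lemma other_factors_neq0 z : other_factors z z != 0.
Proof. by rewrite prodf_seq_neq0; apply/allP => y _; apply/implyP; rewrite subr_eq0 eq_sym. Qed.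

(* Delta divided by the product of its factors [z - y]; at a zero, the removable singularity
   is filled with the leading Taylor coefficient. *)
Definition quotient z :=
  dDelta (count_mem z zs) z / (count_mem z zs)`!%:R / other_factors z z.

Lemma other_factors_all z : z \notin zs -> other_factors z z = \prod_(y <- zs) (z - y).
Proof. by move=> /count_memPn zn; rewrite (prod_factors z) zn expr0 mul1r. Qed.

Lemma quotient_notin z : z \notin zs -> quotient z = Delta z / \prod_(y <- zs) (z - y).
Proof.
by move=> zn; rewrite /quotient other_factors_all// (count_memPn zn) fact0 divr1 dDelta0.
Qed.

Lemma Delta_quotient z : Delta z = quotient z * \prod_(y <- zs) (z - y).
Proof.
have [zin|zn] := boolP (z \in zs).
  have c0 : (0 < count_mem z zs)%N by rewrite -has_count has_pred1.
  have [/(_ 0%N c0) Dz _] := zs_mult zin.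
  by rewrite (prod_factors z) subrr expr0n gtn_eqF// mul0r mulr0; exact: Dz.
rewrite quotient_notin// divfK// prodf_seq_neq0; apply/allP => y yin /=.
by rewrite subr_eq0; apply: contraNneq zn => ->.
Qed.

Lemma quotient_neq0 z : Delta z != 0 \/ z \in zs -> quotient z != 0.
Proof.
move=> H; have TD := local_taylor_dDelta xi tau_gt0 N_int.
have D0 : dDelta (count_mem z zs) z != 0.
  have [zin|zn] := boolP (z \in zs).
    have := zs_mult zin; rewrite -dDelta0 => zm.
    by have [] := zero_mult_leading TD zm.
  by rewrite (count_memPn zn) dDelta0; case: H => //; rewrite (negbTE zn).
by rewrite /quotient !mulf_neq0// invr_eq0 ?other_factors_neq0// pnatr_eq0 -lt0n fact_gt0.
Qed.

(** Near [z] the quotient is [h / other_factors z], where [h] is Delta divided by [(w - z)^k] and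
    filled in at [z]. The Taylor expansion of order [k + 1] shows that [h] differs from its value at
    [z] by [O(|w - z|)]. *)
Lemma pcont_quotient : pcont quotient.
Proof.
move=> p; set z := p.1 +i* p.2; set k := count_mem z zs.
have TD := local_taylor_dDelta xi tau_gt0 N_int.
pose c := dDelta k z / k`!%:R.
pose h w := if w == z then c else Delta w / (w - z) ^+ k.
have Dj j : (j < k)%N -> dDelta j z = 0.
  move=> jk; have zin : z \in zs by rewrite -has_pred1 has_count (leq_ltn_trans _ jk).
  have [] := zs_mult zin; rewrite -/k -dDelta0 => /(_ j jk) + _.
  by rewrite local_taylor_derive1n.
have ch : ccont (fun q : R * R => h (q.1 +i* q.2)) p.
  apply: ccont_of_lipschitz; rewrite -/z; exists (dDelta_bnd tau xi N 0 k.+1 z) => w w1.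
  have [->|w0] := eqVneq w 0; first by rewrite addr0 subrr normc0 mulr0.
  have zw : (z + w == z) = false.
    by rewrite -[X in _ == X]addr0 (inj_eq (addrI z)); exact: negbTE.
  rewrite /h eqxx zw addrAC subrr add0r.
  have := dDelta_taylor_unit xi tau_gt0 N_int 0 k.+1 z w1.
  rewrite big_ord_recr/= big1 ?add0r ?add0n => [|j _]; last by rewrite ?add0n Dj ?ltn_ord ?mul0r.
  have wk : w ^+ k != 0 by rewrite expf_neq0.
  have -> : dDelta 0 (z + w) - dDelta k z * w ^+ k / k`!%:R =
      w ^+ k * (Delta (z + w) / w ^+ k - c).
    by rewrite dDelta0 mulrBr [w ^+ k * (_ / _)]mulrC divfK// /c; congr (_ - _); ring.
  rewrite normcM normcX exprSr mulrA mulrC => H.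
  have n0 : 0 < normc w ^+ k by rewrite exprn_gt0// normc_gt0.
  by rewrite -(ler_pM2r n0); apply: (le_trans H); rewrite mulrAC.
have cQ : ccont (fun q : R * R => other_factors z (q.1 +i* q.2)) p.
  rewrite /other_factors; under eq_fun do rewrite -big_filter.
  apply: ccont_prod => y; apply: ccontB; last exact: ccont_cst.
  by split; [exact: cvg_fst|exact: cvg_snd].
have Qz : other_factors z z != 0 by exact: other_factors_neq0.
have near_eq : \forall q \near p, h (q.1 +i* q.2) / other_factors z (q.1 +i* q.2) =
    quotient (q.1 +i* q.2).
  have [Qr Qi] := cQ.
  have cn : {for p, continuous (fun q : R * R => Re (other_factors z (q.1 +i* q.2)) *
      Re (other_factors z (q.1 +i* q.2)) + Im (other_factors z (q.1 +i* q.2)) *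
      Im (other_factors z (q.1 +i* q.2)))}.
    by apply: continuousD; exact: continuousM.
  have : \forall q \near p, 0 < Re (other_factors z (q.1 +i* q.2)) *
      Re (other_factors z (q.1 +i* q.2)) + Im (other_factors z (q.1 +i* q.2)) *
      Im (other_factors z (q.1 +i* q.2)).
    by apply: (cvgr_gt _ cn); rewrite -!expr2 -normc_sqr exprn_gt0// normc_gt0.
  apply: filterS => q; set y := q.1 +i* q.2; rewrite -!expr2 -normc_sqr => Qy.
  have {}Qy : other_factors z y != 0.
    by rewrite -normc_gt0 lt_neqAle normc_ge0 andbT eq_sym -sqrf_eq0 gt_eqF.
  rewrite /h; have [->//|yz] := eqVneq y z.
  have yn : y \notin zs.
    apply/negP => yin; move: Qy; rewrite prodf_seq_neq0 => /allP/(_ y yin).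
    by rewrite yz subrr eqxx.
  by rewrite quotient_notin// (prod_factors z) invfM mulrA.
have [qr qi] : ccont (fun q : R * R => h (q.1 +i* q.2) / other_factors z (q.1 +i* q.2)) p.
  by apply: ccontM => //; exact: ccontV.
have near_cont (L : R[i] -> R) :
    {for p, continuous (fun q : R * R => L (h (q.1 +i* q.2) / other_factors z (q.1 +i* q.2)))} ->
    {for p, continuous (fun q : R * R => L (quotient (q.1 +i* q.2)))}.
  move=> cL; rewrite /prop_for /continuous_at -(nbhs_singleton near_eq).
  apply: cvg_trans cL; apply: near_eq_cvg; move: near_eq; apply: filterS => q /=.
  by move=> ->.
by split; apply: near_cont.
Qed.

End quotient_by_zeros.

(** * Continuous arguments of a linear factor along the half-circle and the axis *)

Section linear_factor_arguments.
Variable R : realType.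
Implicit Types (z : R[i]) (W t r : R).

Definition arc W t : R[i] := W%:C * cis t.

Lemma is_arg_pos (a : R) (z : R[i]) t : 0 < a -> is_arg z t -> is_arg (a%:C * z) t.
Proof.
by move=> a0; rewrite /is_arg normcM normc_real (gtr0_norm a0) rmorphM/= -mulrA => {1}->.
Qed.

Lemma is_arg_ReIm z t : is_arg z t ->
  Re z = normc z * cos t /\ Im z = normc z * sin t.
Proof.
by move=> zt; split; rewrite {1}zt !ReImE mul0r ?subr0 ?addr0.
Qed.

Lemma is_arg_arc W t : 0 < W -> is_arg (arc W t) t.
Proof. by move=> W0; apply: is_arg_pos => //; exact: is_arg_cis. Qed.

Lemma normc_arc W t : 0 < W -> normc (arc W t) = W.
Proof. by move=> W0; rewrite normcM normc_real normc_cis mulr1 gtr0_norm. Qed.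

Lemma arc_neq0 W t : 0 < W -> arc W t != 0.
Proof. by move=> W0; rewrite -normc_gt0 normc_arc. Qed.

Lemma Re_one_sub_gt0 z : normc z < 1 -> 0 < Re (1 - z).
Proof.
move=> z1; rewrite Re_add Re_opp -[Re 1]/(1 : R) subr_gt0.
by apply: le_lt_trans z1; apply: (le_trans (ler_norm _)); exact: ler_normr_Re.
Qed.

Lemma Re_one_sub_arc_gt0 W z t : 0 < W -> normc z < W -> 0 < Re (1 - z / arc W t).
Proof.
move=> W0 zW; apply: Re_one_sub_gt0.
by rewrite normcM normcV ?arc_neq0// normc_arc// ltr_pdivrMr// mul1r.
Qed.

(** [arc W t] is factored out; for [|z| < W] the other factor lies in the unit disc about [1], hence
    has a principal argument. *)
Definition arc_arg W z t := t + aarg (1 - z / arc W t).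

Lemma is_arg_arc_arg W z t : 0 < W -> normc z < W -> is_arg (arc W t - z) (arc_arg W z t).
Proof.
move=> W0 zW; have -> : arc W t - z = arc W t * (1 - z / arc W t).
  by rewrite mulrBr mulr1 mulrC divfK// arc_neq0.
by apply: is_argM; [exact: is_arg_arc|exact/is_arg_aarg/Re_one_sub_arc_gt0].
Qed.

(** For [z] in the right half-plane the factor [ir - z] lies in the left one, so the principal
    argument is taken of its opposite. *)
Definition axis_arg z r := pi + aarg (z - (0 +i* r)).

Lemma is_arg_axis_arg z r : 0 < Re z -> is_arg ((0 +i* r) - z) (axis_arg z r).
Proof.
move=> z0; rewrite -opprB; apply: is_argN; apply: is_arg_aarg.
by rewrite Re_add Re_opp Re_mk subr0.
Qed.

Lemma arc_pihalf W : arc W (pi / 2) = 0 +i* W.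
Proof.
by apply: complex_eq; rewrite !ReImE cos_pihalf sin_pihalf ?mulr0 ?mul0r ?mulr1 ?subr0 ?addr0.
Qed.

Lemma arc_Npihalf W : arc W (- (pi / 2)) = 0 +i* - W.
Proof.
apply: complex_eq; rewrite !ReImE cosN sinN cos_pihalf sin_pihalf ?mulr0 ?mul0r ?subr0 ?addr0//.
by rewrite mulrN1.
Qed.

Lemma cis_2pi : cis (2 * pi) = 1 :> R[i].
Proof. by rewrite -[2 * pi]/((1 + 1) * pi) mulrDl mul1r /cis cosDpi cospi sinDpi sinpi opprK oppr0. Qed.

(* [arc_arg] and [axis_arg] are arguments of the factor [s - z] along the half-circle and
   along the imaginary axis; they agree at the upper end and differ by one turn at the lower
   end because [z] is enclosed. *)
Lemma arc_axis_arg_upper W z : 0 < W -> normc z < W -> 0 < Re z ->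
  arc_arg W z (pi / 2) = axis_arg z W.
Proof.
move=> W0 zW z0; apply/eqP; rewrite -subr_eq0; apply/eqP; apply: cis_eq1_lt.
  apply: (@is_arg_uniq _ (arc W (pi / 2) - z)).
  - by rewrite subr_eq0; apply: contraTneq zW => <-; rewrite normc_arc// ltxx.
  - exact: is_arg_arc_arg.
  - by rewrite arc_pihalf; exact: is_arg_axis_arg.
(* Both principal arguments are below [pi / 2] in modulus, which keeps the difference within one
   turn and forces it to be 0. *)
rewrite /arc_arg /axis_arg; move: (aarg_itv (1 - z / arc W (pi / 2))) (aarg_itv (z - (0 +i* W))).
by have := pi_gt0 R; lra.
Qed.

Lemma arc_axis_arg_lower W z : 0 < W -> normc z < W -> 0 < Re z ->
  axis_arg z (- W) = arc_arg W z (- (pi / 2)) + 2 * pi.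
Proof.
move=> W0 zW z0; apply/eqP; rewrite -subr_eq0; apply/eqP; apply: cis_eq1_lt.
  rewrite opprD addrA cisD.
  have -> : cis (- (2 * pi)) = 1 :> R[i].
    by apply: (mulfI (cis_neq0 (2 * pi))); rewrite -cisD subrr cis0 cis_2pi mulr1.
  rewrite mulr1; apply: (@is_arg_uniq _ (arc W (- (pi / 2)) - z)).
  - by rewrite subr_eq0; apply: contraTneq zW => <-; rewrite normc_arc// ltxx.
  - by rewrite arc_Npihalf; exact: is_arg_axis_arg.
  - exact: is_arg_arc_arg.
rewrite /arc_arg /axis_arg; move: (aarg_itv (1 - z / arc W (- (pi / 2)))) (aarg_itv (z - (0 +i* - W))).
by have := pi_gt0 R; lra.
Qed.

Lemma ccont_arc W (t : R) : ccont (arc W : R -> R[i]) t.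
Proof.
apply: (ccontM (f := fun=> W%:C) (g := (@cis R))); first exact: ccont_cst.
by split; [exact: continuous_cos|exact: continuous_sin].
Qed.

Lemma continuous_arc_arg W z (t : R) : 0 < W -> normc z < W ->
  {for t, continuous (arc_arg W z : R -> R)}.
Proof.
move=> W0 zW; apply: continuousD; first exact: cvg_id.
apply: (ccont_aarg (f := fun t => 1 - z / arc W t)); first exact: Re_one_sub_arc_gt0.
apply: ccontB; first exact: ccont_cst.
apply: (ccontM (f := fun=> z) (g := fun t => (arc W t)^-1)); first exact: ccont_cst.
by apply: ccontV; [exact: arc_neq0|exact: ccont_arc].
Qed.

Lemma ccont_axis (r : R) : ccont (fun y : R => 0 +i* y) r.
Proof. by split; [exact: cst_continuous|exact: cvg_id]. Qed.

Lemma continuous_axis_arg z (r : R) : 0 < Re z ->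
  {for r, continuous (axis_arg z : R -> R)}.
Proof.
move=> z0; apply: continuousD; first exact: cst_continuous.
apply: (ccont_aarg (f := fun r => z - (0 +i* r))).
  by rewrite Re_add Re_opp Re_mk subr0.
by apply: ccontB; [exact: ccont_cst|exact: ccont_axis].
Qed.

End linear_factor_arguments.

Section argument_principle.
Variables (R : realType) (f g : R[i] -> R[i]) (zs : seq R[i]) (W : R).
Implicit Types (z : R[i]) (r t : R).
Hypotheses (W_gt0 : 0 < W) (cf : pcont f) (cg : pcont g)
  (fE : forall z, f z = g z * \prod_(y <- zs) (z - y))
  (g_neq0 : forall z, half_square W z -> g z != 0)
  (zs_Re : forall y, y \in zs -> 0 < Re y) (zs_lt : forall y, y \in zs -> normc y < W)
  (f_axis : forall r, f (0 +i* r) != 0)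
  (f_arc : forall z, 0 <= Re z -> normc z = W -> 0 < Re (f z))
  (f_even : forall r, Re (f (0 +i* - r)) = Re (f (0 +i* r)))
  (f_odd : forall r, Im (f (0 +i* - r)) = - Im (f (0 +i* r))).

Lemma is_arg_prod_in (F : R[i] -> R[i]) (G : R[i] -> R) :
  (forall y, y \in zs -> is_arg (F y) (G y)) ->
  is_arg (\prod_(y <- zs) F y) (\sum_(y <- zs) G y).
Proof.
move=> FG; rewrite [X in is_arg X _]big_seq [X in is_arg _ X]big_seq.
elim/big_ind2: _ => [|z t w u|i iz]; last exact: FG.
  by rewrite -(@cis0 R); exact: is_arg_cis.
exact: is_argM.
Qed.

Lemma continuous_sum_in (F : R[i] -> R -> R) (x : R) :
  (forall y, y \in zs -> {for x, continuous (F y)}) ->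
  {for x, continuous (fun t => \sum_(y <- zs) F y t)}.
Proof.
move=> cF; apply: (@continuous_ext _ _ (fun t => \sum_(y <- zs) (if y \in zs then F y t else 0))).
  by move=> t; rewrite big_seq [RHS]big_seq; apply: eq_bigr => y ->.
by apply: continuous_sum => y; case: (boolP (y \in zs)) => [/cF//|_]; exact: cst_continuous.
Qed.

Lemma half_square_axis r : - W <= r <= W -> half_square W (0 +i* r).
Proof. by move=> rW; split; rewrite ?Re_mk ?Im_mk// lexx ltW. Qed.

Lemma half_square_arc t : - (pi / 2) <= t <= pi / 2 -> half_square W (arc W t).
Proof.
move=> tpi; have c0 := cos_ge0_pihalf tpi; have c1 := cos_le1 t.
have s1 := sin_le1 t; have s2 := sin_geN1 t.
split; rewrite !ReImE mul0r ?subr0 ?addr0; apply/andP; split.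
- by rewrite mulr_ge0// ltW.
- by rewrite ler_piMr// ltW.
- by rewrite -mulrN1 ler_pM2l.
- by rewrite ler_piMr// ltW.
Qed.

(* [F] below is the difference of two arguments of [f] along the arc, hence constant; this
   relates the variations of [theta] along the arc and along the axis.  The symmetry of [f]
   halves the variation along the axis. *)
Lemma argument_principle : exists2 phi : R -> R,
  forall r, 0 <= r <= W -> is_arg (f (0 +i* r)) (phi r) /\ {for r, continuous phi} &
  phi 0 - phi W = (size zs)%:R * pi - aarg (f (0 +i* W)).
Proof.
have [theta thetaP ctheta] := argument_lift W_gt0 cg g_neq0.
pose psi r := theta (0 +i* r) + \sum_(y <- zs) axis_arg y r.
have psiP r : - W <= r <= W -> is_arg (f (0 +i* r)) (psi r).
  move=> rW; rewrite fE; apply: is_argM; first exact/thetaP/half_square_axis.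
  by apply: is_arg_prod_in => y /zs_Re; exact: is_arg_axis_arg.
have cpsi r : - W <= r <= W -> {for r, continuous psi}.
  move=> rW; apply: continuousD.
    by apply: (ctheta _ (fun y : R => 0 +i* y)); [exact: ccont_axis|exact: half_square_axis].
  by apply: continuous_sum_in => y /zs_Re; exact: continuous_axis_arg.
exists psi.
  move=> r /andP[r0 rW]; have rr : - W <= r <= W by rewrite rW andbT (le_trans _ r0)// oppr_le0 ltW.
  by split; [exact: psiP|exact: cpsi].
have pi0 := pi_gt0 R.
pose F t := aarg (f (arc W t)) - (theta (arc W t) + \sum_(y <- zs) arc_arg W y t).
have Nle : - (pi / 2) <= pi / 2 :> R by lra.
have arc_Re t : - (pi / 2) <= t <= pi / 2 -> 0 < Re (f (arc W t)).
  by move=> tpi; apply: f_arc; [case: (half_square_arc tpi) => /andP[]|exact: normc_arc].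
have FE : F (- (pi / 2)) = F (pi / 2).
  apply: (cis_eq1_constant Nle).
    apply: continuous_in_subspaceT => t; rewrite inE/= in_itv/= => tpi.
    apply: (@continuousB _ _ _ (fun t : R => aarg (f (arc W t)))
      (fun t : R => theta (arc W t) + \sum_(y <- zs) arc_arg W y t)).
      apply: (ccont_aarg (f := fun t => f (arc W t))); first exact: arc_Re.
      by apply: (pcont_comp cf); exact: ccont_arc.
    apply: continuousD.
      by apply: ctheta; [exact: ccont_arc|exact: half_square_arc].
    by apply: continuous_sum_in => y yzs; apply: continuous_arc_arg => //; exact: zs_lt.
  move=> t tpi; apply: (@is_arg_uniq _ (f (arc W t))).
  - by apply/eqP => f0; have := arc_Re t tpi; rewrite f0 ltxx.
  - exact/is_arg_aarg/arc_Re.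
  - rewrite fE; apply: is_argM; first exact/thetaP/half_square_arc.
    by apply: is_arg_prod_in => y yzs; apply: is_arg_arc_arg => //; exact: zs_lt.
have fW : aarg (f (0 +i* - W)) = - aarg (f (0 +i* W)).
  by rewrite /aarg f_even f_odd mulNr atanN.
(* The product of [f] at [ir] and [-ir] is the square of a modulus, so [psi r + psi (- r)] is an
   argument of a positive number and hence constant. *)
have sym : psi 0 + psi (- 0) = psi W + psi (- W).
  apply: (@cis_eq1_constant _ (fun r => psi r + psi (- r)) 0 W (ltW W_gt0)).
    apply: continuous_in_subspaceT => r; rewrite inE/= in_itv/= => /andP[r0 rW].
    have Nr : - W <= - r by rewrite lerN2.
    apply: (@continuousD _ _ _ psi (fun r : R => psi (- r))).
      by apply: cpsi; rewrite rW andbT (le_trans _ r0)// oppr_le0 ltW.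
    apply: (@continuous_comp _ _ _ (fun r : R => - r) psi).
      exact: (@continuousN _ _ _ id r (@cvg_id _ _)).
    by apply: cpsi; rewrite Nr (le_trans _ (ltW W_gt0))// oppr_le0.
  move=> r /andP[r0 rW].
  have rr : - W <= r <= W by rewrite rW andbT (le_trans _ r0)// oppr_le0 ltW.
  have Nrr : - W <= - r <= W by rewrite lerN2 rW (le_trans _ (ltW W_gt0))// oppr_le0.
  have prodE : f (0 +i* r) * f (0 +i* - r) = (normc (f (0 +i* r)) ^+ 2)%:C.
    apply: complex_eq.
    - by rewrite Re_mul f_even f_odd Re_real normc_sqr; ring.
    - by rewrite Im_mul f_even f_odd Im_real; ring.
  have := is_argM (psiP r rr) (psiP (- r) Nrr); rewrite prodE => h.
  have n0 : 0 < normc (f (0 +i* r)) ^+ 2 by rewrite exprn_gt0// normc_gt0.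
  have nn : (normc (f (0 +i* r)) ^+ 2)%:C != 0.
    by rewrite -normc_gt0 normc_real normr_gt0 gt_eqF.
  have h0 : is_arg (normc (f (0 +i* r)) ^+ 2)%:C 0.
    by rewrite /is_arg normc_real cis0 mulr1 ger0_norm// ltW.
  by have := is_arg_uniq nn h h0; rewrite subr0.
move: FE sym; rewrite /F arc_pihalf arc_Npihalf fW oppr0 /psi.
have -> : \sum_(y <- zs) arc_arg W y (pi / 2) = \sum_(y <- zs) axis_arg y W.
  by rewrite big_seq [RHS]big_seq; apply: eq_bigr => y yz; apply: arc_axis_arg_upper; auto.
have -> : \sum_(y <- zs) axis_arg y (- W) =
    \sum_(y <- zs) arc_arg W y (- (pi / 2)) + (size zs)%:R * (2 * pi).
  have -> : (size zs)%:R * (2 * pi) = \sum_(y <- zs) 2 * pi :> R.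
    by rewrite big_const_seq count_predT iter_addr_0 mulr_natl.
  rewrite -big_split/= big_seq [RHS]big_seq; apply: eq_bigr => y yz.
  by apply: arc_axis_arg_lower; auto.
(* With [n] zeros, [FE] gives psi(-W) - psi(W) = 2 n pi - 2 aarg(f(iW)), and [sym] makes psi(0) the
   mean of psi(W) and psi(-W). *)
lra.
Qed.

End argument_principle.

(* [compact_cover], used on [R * R], requires a pointed topological type. *)
HB.instance Definition _ (T U : ptopologicalType) := Pointed.on (T * U)%type.

(** * Finiteness and enumeration of the zeros *)

Section zero_lists.
Variables (R : realType) (tau xi : R) (N : R -> R).
Local Notation mu := (@lebesgue_measure R).
Hypotheses (tau_gt0 : 0 < tau) (N_int : mu.-integrable `[0, tau] (EFin \o N))
  (xi_lt1 : `|xi| < 1) (N_lt : Rintegral mu `[0, tau] N < 1 - xi).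
Local Notation Delta := (Delta tau xi N).
Local Notation M := (Mfun tau xi N).

(** From [W] on [M] is positive, so its positive zeros lie in a compact segment, where isolated
    zeros are finite in number. *)
Lemma Mfun_zeros_exist :
  exists rho, lists_zeros M [set omega | 0 < omega] rho /\ sorted >=%R rho.
Proof.
have TM := local_taylor_dM xi tau_gt0 N_int.
have [W W0 HW] := Re_Delta_gt0 tau_gt0 N_int xi_lt1.
have fin : finite_set (`[0, W]%classic `&` [set x | M x = 0]).
  apply: finite_set_compact_discrete; first exact: segment_compact.
  move=> x _; have [e e0 He] := zero_isolated TM (dM_neq0 tau_gt0 N_int N_lt x).
  apply/nbhs_ballP; exists e => // y xy /= My; apply: contrapT => /eqP yx.
  have := He (y - x); rewrite normr_gt0 subr_eq0 => /(_ yx).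
  by rewrite distrC [x + (y - x)]addrC subrK dM0 => /(_ xy); rewrite My eqxx.
have [|x _|s [s1 s2]] := lists_zeros_exists (A := [set omega | 0 < omega]) TM.
- apply: sub_finite_set fin => x /= [x0]; rewrite dM0 => Mx; split => //=.
  rewrite in_itv/= (ltW x0)/= leNgt; apply/negP => Wx.
  have := HW (0 +i* x); rewrite Re_mk normc_imag (gtr0_norm x0) => /(_ (lexx _) (ltW Wx)).
  by rewrite -[Re _]/(M x) Mx ltxx.
- exact: dM_neq0.
rewrite dM0 in s2; exists (sort >=%R s); split; last first.
  by apply: sort_sorted => x y; exact: le_total.
split=> [z|z /s2]; first by rewrite mem_sort; exact: s1.
by have /permP -> := permEl (perm_sort >=%R s).
Qed.

Lemma Delta_zeros_exist :
  exists zs, lists_zeros Delta [set s : R[i] | 0 < Re s] zs.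
Proof.
have TD := local_taylor_dDelta xi tau_gt0 N_int.
have [W W0 HW] := Re_Delta_gt0 tau_gt0 N_int xi_lt1.
pose K := [set` `[0, W]] `*` [set` `[- W, W]] : set (R * R).
have fin : finite_set (K `&` [set p | Delta (p.1 +i* p.2) = 0]).
  apply: finite_set_compact_discrete; first by apply: compact_setX; exact: segment_compact.
  move=> p _; have [e e0 He] := zero_isolated TD (dDelta_neq0 tau_gt0 N_int N_lt (p.1 +i* p.2)).
  (* A positive element of [R[i]] is a positive real number. *)
  have [Re_e eE] : 0 < Re e /\ e = (Re e)%:C.
    by move: e0; case: (e) => a b; rewrite ltcE /= => /andP[/eqP-> ->].
  apply/nbhs_ballP; exists (Re e / 2); first by rewrite /= divr_gt0.
  move=> q [q1 q2] /= Dq; apply: contrapT => qp.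
  pose w := (q.1 - p.1) +i* (q.2 - p.2).
  have qE : q.1 +i* q.2 = p.1 +i* p.2 + w.
    by apply: complex_eq; rewrite !ReImE addrC subrK.
  have w0 : w != 0.
    apply/eqP => w0; apply: qp; rewrite w0 addr0 in qE.
    by case: qE; case: (p) (q) => [a b] [c d] /= -> ->.
  have := He w; rewrite -qE dDelta0 Dq eqxx normr_gt0 w0 => /(_ isT).
  rewrite eE -[`|w|]/((normc w)%:C) ltcR => /(_ _)/negP; apply => //.
  apply: (le_lt_trans (normc_le _)); rewrite [Re e]splitr.
  by apply: ltrD; rewrite distrC.
have [|z _|s] := lists_zeros_exists (A := [set s : R[i] | 0 < Re s]) TD.
- apply: sub_finite_set (finite_image (fun p : R * R => p.1 +i* p.2) fin) => z /= [z0].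
  rewrite dDelta0 => Dz; exists (Re z, Im z); last by case: (z).
  split; last by rewrite /=; case: (z) Dz.
  have zW : normc z < W.
    by rewrite ltNge; apply/negP => /(HW z (ltW z0)); rewrite Dz ltxx.
  have := ler_normr_Re z; have := ler_normr_Im z; rewrite !ler_norml => i1 r1.
  by split; rewrite /= in_itv/=; lra.
- exact: dDelta_neq0.
by rewrite dDelta0; exists s.
Qed.

End zero_lists.

(** * Comparison of the argument principle with the crossing count *)

Unset Implicit Arguments.

Theorem theorem2 (R : realType) (tau xi : R) (N : R -> R)
  (tau_gt0 : 0 < tau)
  (N_int : (@lebesgue_measure R).-integrable `[0, tau] (EFin \o N))
  (xi_lt1 : `|xi| < 1)
  (Delta_imag : forall omega : R, Delta tau xi N (0 +i* omega) != 0)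
  (N_lt : Rintegral (@lebesgue_measure R) `[0, tau] N < 1 - xi) :
  let positive_zeros_of_M (rho : seq R) :=
    lists_zeros (Mfun tau xi N) [set omega | 0 < omega] rho /\
    sorted >=%R rho in
  (exists rho, positive_zeros_of_M rho) /\
  (forall rho, positive_zeros_of_M rho ->
   exists2 roots : seq R[i],
     lists_zeros (Delta tau xi N) [set s : R[i] | 0 < complex.Re s] roots &
     (size roots)%:R = Gamma tau xi N rho).
Proof.
split; first exact: Mfun_zeros_exist.
move=> rho [[rho_pos rho_mult] rho_sorted].
have [zs zsL] := Delta_zeros_exist tau_gt0 N_int xi_lt1 N_lt.
exists zs => //; have [zs_pos zs_mult] := zsL.
have [W W0 HW] := Re_Delta_gt0 tau_gt0 N_int xi_lt1.
have zsm y : y \in zs -> zero_mult (Delta tau xi N) y (count_mem y zs).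
  by move=> /zs_pos; exact: zs_mult.
have zs_lt y : y \in zs -> normc y < W.
  move=> yzs; rewrite ltNge; apply/negP => /(HW y (ltW (zs_pos y yzs))).
  by rewrite (Delta_quotient zsm) (big_rem y)//= subrr mul0r mulr0 ltxx.
(* On the imaginary axis Delta has no zero by hypothesis; to the right of it every zero is in
   [zs]. *)
have g_neq0 z : half_square W z -> quotient tau xi N zs z != 0.
  move=> [/andP[z0 _] _]; apply: quotient_neq0 => //.
  move: z0; rewrite le_eqVlt => /orP[/eqP z0|z0].
    by left; have := Delta_imag (Im z); congr (Delta _ _ _ _ != 0); case: (z) z0 => a b /= <-.
  have [zin|zn] := boolP (z \in zs); first by right.
  by left; apply: zero_mult_neq0; rewrite -(count_memPn zn); exact: zs_mult.
have [phi phiP phiW] := argument_principle W0 (pcont_Delta xi tau_gt0 N_int)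
  (pcont_quotient tau_gt0 N_int zsm) (Delta_quotient zsm) g_neq0 zs_pos zs_lt
  Delta_imag (fun z z0 zW => HW z z0 (eq_ind W (fun v => W <= v) (lexx W) _ (esym zW)))
  (Mfun_even xi N_int) (Sfun_odd xi N_int).
have pi0 := pi_gt0 R; have M0 := Mfun0_gt0 N_lt.
pose amp x := normc (Delta tau xi N (0 +i* x)).
have amp0 x : 0 < amp x by rewrite normc_gt0.
have ME x : 0 <= x <= W -> Mfun tau xi N x = amp x * cos (phi x).
  by move=> /phiP[/is_arg_ReIm[]].
have SE x : 0 <= x <= W -> Sfun tau xi N x = amp x * sin (phi x).
  by move=> /phiP[/is_arg_ReIm[]].
have W00 : 0 <= (0 : R) <= W by apply/andP; split => //; exact: ltW.
have WW : 0 <= W <= W by apply/andP; split => //; exact: ltW.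
have MW : 0 < Mfun tau xi N W.
  by apply: HW; [rewrite Re_mk|rewrite normc_imag gtr0_norm].
have [k0 near0] : exists k, nearest_mpi (phi 0) k.
  by apply: nearest_mpi_ex; apply: contraTneq M0 => c0; rewrite ME// c0 mulr0 ltxx.
(* [S] is odd, so Delta(0) is real and its argument is an exact multiple of pi. *)
have phi0 : phi 0 = k0%:~R * pi.
  have S0 : Sfun tau xi N 0 = 0 by have := Sfun_odd xi N_int 0; rewrite oppr0; lra.
  have : sin (phi 0 - k0%:~R * pi) = 0.
    move: S0; rewrite SE// (sin_subr_mpi (phi 0) k0) => /eqP; rewrite !mulf_eq0 gt_eqF//=.
    move=> /orP[/eqP//|/eqP c0]; have := cos_mpi_sqr R k0.
    by rewrite c0 mul0r => /esym/eqP; rewrite oner_eq0.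
  move: near0; rewrite /nearest_mpi ltr_norml => /andP[n1 n2] s0.
  apply/eqP; rewrite -subr_eq0; apply/eqP; apply: contrapT => /eqP; rewrite neq_lt => /orP[h|h].
    by have := @sin_gt0_pihalf _ (- (phi 0 - k0%:~R * pi)); rewrite sinN s0 oppr0 ltxx; lra.
  by have := @sin_gt0_pihalf _ (phi 0 - k0%:~R * pi); rewrite s0 ltxx; lra.
(* The deviation of [phi W] from this multiple is a principal argument, of modulus less than
   [pi / 2]. *)
have nearW : nearest_mpi (phi W) (k0 - (size zs)%:Z).
  have -> : phi W = k0%:~R * pi - (size zs)%:R * pi + aarg (Delta tau xi N (0 +i* W)).
    by rewrite -phi0; lra.
  rewrite /nearest_mpi intrB mulrBl -pmulrn addrAC subrr add0r ltr_norml.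
  exact: aarg_itv.
have rho_lt t : t \in rho -> 0 < t < W.
  move=> tr; have t0 : 0 < t := rho_pos t tr; rewrite t0 ltNge; apply/negP => Wt.
  have : 0 < Mfun tau xi N t.
    by apply: HW; [rewrite Re_mk|rewrite normc_imag gtr0_norm].
  have c0 : (0 < count_mem t rho)%N by rewrite -has_count has_pred1.
  by have [/(_ 0%N c0) + _] := rho_mult t t0; rewrite /= => ->; rewrite ltxx.
(* The count is taken up to [b = W], where [M] is positive, so the sign in front of the sum is [1];
   the left-hand side is [k0 - (k0 - size zs)]. *)
have := @crossing_count _ _ (Sfun tau xi N) amp phi W amp0 ME SE (fun x xW => (phiP x xW).2)
  (sgr_like_power_Mfun tau_gt0 N_int) (lt0r_neq0 M0) (size rho) rho W k0 _ (leqnn _) rho_sorted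
  _ (lt0r_neq0 MW) rho_lt _ near0 nearW.
rewrite opprB addrCA subrr addr0 gtr0_sg// mul1r -pmulrn; apply; first by rewrite W0 lexx.
by move=> t /andP[t0 _]; exact: rho_mult.
Qed.
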